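(* Let $d\ge 3$ and $k\ge d-2$ be integers, let $f_1,f_2,f_3\in\mathbb{C}[x,y]$ be general forms of degree $d$, and let $R_{2,d,k}=\mathbb{C}[x,y]/(f_1,f_2,f_3)^k$. Then the Hilbert series of $R_{2,d,k}$ is $$R_{2,d,k}(t)=\sum_{i=0}^{dk-1}(i+1)t^i+\binom{d-1}{2}t^{dk}.$$ The graded Betti numbers of $R_{2,d,k}$ are $$\beta_{0,0}=1,\quad \beta_{1,dk}=\frac{2dk-d^2+3d}{2},\quad \beta_{2,dk+1}=dk-d^2+3d-2,\quad \beta_{2,dk+2}=\binom{d-1}{2}$$ (all other graded Betti numbers being zero).
   Context: A form is a homogeneous polynomial. ''General forms of degree $d$'' means: the statement holds for all $(f_1,f_2,f_3)$ in some nonempty Zariski-open subset (depending on $d$ and $k$) of the space of triples of forms of degree $d$ in $\mathbb{C}[x,y]$. The Hilbert series of a graded algebra $R=\bigoplus_i R_i$ is $R(t)=\sum_i \dim_{\mathbb{C}}(R_i)\,t^i$. The graded Betti numbers are $\beta_{i,j}=\dim_{\mathbb{C}}\operatorname{Tor}_i^{\mathbb{C}[x,y]}(R_{2,d,k},\mathbb{C})_j$, where $j$ is the internal degree. *)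

(* Defs.v *)
From HB Require Import structures.
From mathcomp Require Import all_boot all_order all_algebra.
From mathcomp Require Import mpoly.

Set Implicit Arguments.
Unset Strict Implicit.
Unset Printing Implicit Defensive.

Import GRing.Theory.
Local Open Scope ring_scope.

Section Dimension.
Variables (K : fieldType) (V : lmodType K).

(* [quot_dim A B n]: the vector space (A + B) / B has a basis with n elements,
   for linear subspaces A and B of V; here [b] lifts such a basis to A. *)
Definition quot_dim (A B : V -> Prop) (n : nat) : Prop :=
  exists b : 'I_n -> V,
    [/\ forall i, A (b i),
        forall c : 'I_n -> K, B (\sum_i c i *: b i) -> forall i, c i = 0
      & forall v, A v -> exists c : 'I_n -> K, B (v - \sum_i c i *: b i)].

End Dimension.

Section Ideals.
Variable S : comNzRingType.

Definition ideal_gen (G : S -> Prop) (p : S) : Prop :=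
  exists (m : nat) (c g : 'I_m -> S),
    (forall i, G (g i)) /\ p = \sum_i c i * g i.

Definition ideal_pow (I : S -> Prop) (k : nat) : S -> Prop :=
  ideal_gen (fun p => exists g : 'I_k -> S,
    (forall i, I (g i)) /\ p = \prod_i g i).

End Ideals.

Section GeneralForms.
Variable K : fieldType.

Definition zariski_open (n : nat) (U : 'rV[K]_n -> Prop) : Prop :=
  exists E : {mpoly K[n]} -> Prop,
    forall v, U v <-> exists2 P, E P & P.@[fun i => v 0 i] != 0.

(* Entry (i, j) is the coefficient of x^j y^(d-j) in f i: these are linear
   coordinates on the space of m-tuples of forms of degree d in K[x,y]. *)
Definition coef_mx (m d : nat) (f : 'I_m -> {mpoly K[2]}) : 'M[K]_(m, d.+1) :=
  \matrix_(i, j) (f i)@_[multinom of [:: val j; d - j]%N].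

Definition for_general_forms (m d : nat)
    (P : ('I_m -> {mpoly K[2]}) -> Prop) : Prop :=
  exists U : 'rV[K]_(m * d.+1) -> Prop,
    [/\ zariski_open U,
        exists v, U v
      & forall f : 'I_m -> {mpoly K[2]},
          (forall i, f i \is d.-homog) -> U (mxvec (coef_mx d f)) -> P f].

End GeneralForms.

Section GradedAlgebra.
Variables (K : fieldType) (n : nat).
Local Notation S := {mpoly K[n]}.

(* The power series [\sum_i h i t^i] is the Hilbert series of S/I, for a
   homogeneous ideal I: its degree i part is S_i / (I \cap S_i). *)
Definition hilbert_series (I : S -> Prop) (h : nat -> nat) : Prop :=
  forall i, quot_dim (fun p : S => p \is i.-homog) I (h i).

(* Data of a complex ... -> F_2 -> F_1 -> F_0 -> S/I of graded free S-modules
   of finite rank. F_i has basis e_0, ..., e_(rk i - 1), with e_a of internal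
   degree [sh a]; its elements are row vectors, and maps act on the right.
   The entries of [aug] are representatives in S of the images in S/I of the
   basis of F_0. *)
Record graded_free := GradedFree {
  rk : nat -> nat;
  sh : forall i, 'I_(rk i) -> nat;
  dif : forall i, 'M[S]_(rk i.+1, rk i);
  aug : 'cV[S]_(rk 0)
}.

Definition graded_maps (F : graded_free) : Prop :=
  (forall b, aug F b 0 \is (sh b).-homog) /\
  (forall i a b,
     ((sh b <= sh a)%N -> dif F i a b \is (sh a - sh b)%N.-homog) /\
     ((sh a < sh b)%N -> dif F i a b = 0)).

Definition is_resolution (F : graded_free) (I : S -> Prop) : Prop :=
  [/\ graded_maps F,
      forall p, exists u : 'rV[S]_(rk F 0), I (p - (u *m aug F) 0 0),
      forall u : 'rV[S]_(rk F 0),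
        I ((u *m aug F) 0 0) <-> exists w, u = w *m dif F 0
    & forall i (u : 'rV[S]_(rk F i.+1)),
        u *m dif F i = 0 <-> exists w, u = w *m dif F i.+1].

(* F_i (x)_S K, where K = S/(X_0, ..., X_(n-1)), is K^(rk i) with the induced
   basis, and the differential becomes the matrix of constant coefficients. *)
Definition dif0 (F : graded_free) (i : nat) : 'M[K]_(rk F i.+1, rk F i) :=
  map_mx (mcoeff 0%MM) (dif F i).

Definition in_degree (F : graded_free) (i j : nat) (v : 'rV[K]_(rk F i)) :=
  forall b, v 0 b != 0 -> sh b = j.

Definition tor_cycle (F : graded_free) (i j : nat) :
    'rV[K]_(rk F i) -> Prop :=
  match i with
  | 0 => fun v => in_degree j v
  | i'.+1 => fun v => in_degree j v /\ v *m dif0 F i' = 0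
  end.

Definition tor_boundary (F : graded_free) (i j : nat) (v : 'rV[K]_(rk F i)) :=
  exists w : 'rV[K]_(rk F i.+1), in_degree j w /\ v = w *m dif0 F i.

(* dim_K Tor_i^S(S/I, K)_j = b. Tor is the homology of F (x)_S K for a graded
   free resolution F of S/I; it does not depend on F up to isomorphism, and
   finite ranks and nonnegative shifts suffice since S is noetherian and S/I
   is finitely generated in degree 0. *)
Definition graded_betti (I : S -> Prop) (i j b : nat) : Prop :=
  exists F : graded_free, is_resolution F I /\
    quot_dim (@tor_cycle F i j) (@tor_boundary F i j) b.

End GradedAlgebra.

(* Main.v *)
Require Import Defs.
From HB Require Import structures.
From mathcomp Require Import all_boot all_order all_algebra.
From mathcomp Require Import perm mpoly complex reals.
From mathcomp Require Import zify ring.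
Set Implicit Arguments.
Unset Strict Implicit.
Unset Printing Implicit Defensive.
Import GRing.Theory.
Local Open Scope ring_scope.

(* Put D = dk, I = (f1,f2,f3)^k, S = C[x,y], and let f1, f2, f3 be general.
   - If S_{2d-1} = f1 S_{d-1} + f2 S_{d-1}, then f3 acts on the vector v of the
     monomials of degree d-1 as f1 A + f2 B for constant matrices A and B.  Hence
     det (f3 - f1 A - f2 B) kills v, so it vanishes: this is the implicit equation
     of degree d of the curve parametrised by (f1,f2,f3), monic in f3.  So I_D is
     spanned by the N = D + 1 - C(d-1,2) products f1^i f2^j f3^l with l < d.
   - Independence of these N products and S_1 I_D = S_{D+1} are open conditions
     too.  All three hold for (x^d, y^d, x y^(d-1) + x^(d-1) y).
   - Let W be a subspace of S_D of dimension N with S_1 W = S_{D+1}.  The syzygies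
     of a basis g of W are generated by the linear ones and by x p + y q, where
     p.g = y c, q.g = - x c and c runs over a basis of a complement of W in S_D:
     if x p + y q is a syzygy of degree e, then p.g = y h and q.g = - x h for some
     h, which lies in (W) as soon as e > 2.  There are N - 1 of these syzygies, so
     they form a basis, and they give the minimal resolution of S/(W). *)

(** * Binary forms as univariate polynomials *)

Section Dehomogenisation.
Variable K : fieldType.
Local Notation S := {mpoly K[2]}.
Local Notation x := ('X_ord0 : S).
Local Notation y := ('X_ord_max : S).

Definition bimon (n j : nat) : 'X_{1..2} := [multinom of [:: j; n - j]%N].

Lemma bimon0 n j : bimon n j ord0 = j.
Proof. by rewrite multinomE. Qed.

Lemma bimon1 n j : bimon n j ord_max = (n - j)%N.
Proof. by rewrite multinomE. Qed.

Lemma mdeg2 (m : 'X_{1..2}) : mdeg m = (m ord0 + m ord_max)%N.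
Proof. by rewrite mdegE big_ord_recr big_ord1 /=; congr (m _ + _)%N; apply: val_inj. Qed.

Lemma mdeg_bimon n j : (j <= n)%N -> mdeg (bimon n j) = n.
Proof. by move=> jn; rewrite mdeg2 bimon0 bimon1 subnKC. Qed.

Lemma bimon_mdeg (m : 'X_{1..2}) : m = bimon (mdeg m) (m ord0).
Proof.
apply/mnmP=> i; rewrite mdeg2; case: (unliftP ord0 i) => [j|] ->; last by rewrite bimon0.
by rewrite ord1 (_ : lift _ _ = ord_max) ?bimon1 ?addKn //; apply: val_inj.
Qed.

(** Setting y = 1 is injective on the forms of a fixed degree n, so linear algebra on S_n becomes
    linear algebra on polynomials of size at most n + 1. *)
Definition dehomog (p : S) : {poly K} :=
  mmap (@polyC K) (fun i : 'I_2 => if i == ord0 then 'X else 1) p.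

HB.instance Definition _ := GRing.RMorphism.copy dehomog
  (mmap (@polyC K) (fun i : 'I_2 => if i == ord0 then 'X else 1)).

Lemma dehomog_mon m : dehomog 'X_[m] = 'X^(m ord0).
Proof.
rewrite /dehomog mmapX /mmap1 big_ord_recr big_ord1 /= expr1n mulr1.
by congr ('X ^+ (m _)); apply: val_inj.
Qed.

Lemma dehomogX0 : dehomog x = 'X.
Proof. by rewrite dehomog_mon mnm1E. Qed.

Lemma dehomogX1 : dehomog y = 1.
Proof. by rewrite dehomog_mon mnm1E. Qed.

Lemma dehomogZ c p : dehomog (c *: p) = c *: dehomog p.
Proof. by rewrite /dehomog mmapZ mul_polyC. Qed.

(** Coefficients of [q] beyond degree [n] are dropped, hence the size bound in [homogeniseK]. *)
Definition homogenise (n : nat) (q : {poly K}) : S :=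
  \sum_(j < n.+1) q`_j *: 'X_[bimon n j].

Lemma homogenise_homog n q : homogenise n q \is n.-homog.
Proof.
apply: rpred_sum => j _; apply: rpredZ.
by rewrite dhomogX /= mdeg_bimon // -ltnS.
Qed.

Lemma dehomogK n p : p \is n.-homog -> homogenise n (dehomog p) = p.
Proof.
move=> hp; rewrite [in RHS](mpolyE p).
have -> : dehomog p = \sum_(m <- msupp p) p@_m *: 'X^(m ord0).
  by apply: eq_bigr => m _; rewrite mul_polyC -dehomog_mon /dehomog mmapX.
rewrite /homogenise; under eq_bigr do rewrite coef_sum scaler_suml.
rewrite exchange_big /= big_seq [RHS]big_seq; apply: eq_bigr => m mp.
have dm : mdeg m = n by have /dhomogP/(_ m mp) := hp.
have mn : (m ord0 < n.+1)%N by rewrite ltnS -dm mdeg2 leq_addr.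
rewrite (bigD1 (Ordinal mn)) //= big1 => [|j /negPf jm].
  by rewrite coefZ coefXn eqxx mulr1 addr0 /= -dm -bimon_mdeg.
by rewrite coefZ coefXn -val_eqE /= in jm *; rewrite jm mulr0 scale0r.
Qed.

Lemma homogeniseK n (q : {poly K}) : (size q <= n.+1)%N -> dehomog (homogenise n q) = q.
Proof.
move=> sq; rewrite /homogenise raddf_sum /=.
under eq_bigr do rewrite dehomogZ dehomog_mon bimon0.
by rewrite -[in RHS](coefK q) (poly_def) (big_ord_widen _ (fun i => q`_i *: 'X^i) sq)
  [LHS](bigID (fun i : 'I__ => (i < size q)%N)) /= [X in _ + X]big1 ?addr0 // => i;
  rewrite -leqNgt => /(nth_default 0) ->; rewrite scale0r.
Qed.

Lemma coef_dehomog n p j : p \is n.-homog -> (j <= n)%N ->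
  (dehomog p)`_j = p@_(bimon n j).
Proof.
move=> hp jn; rewrite -[in RHS](dehomogK hp) /homogenise raddf_sum /=.
rewrite (bigD1 (Ordinal (jn : (j < n.+1)%N))) //= mcoeffZ mcoeffX eqxx mulr1 big1 ?addr0 //.
move=> i /negPf ij; rewrite mcoeffZ mcoeffX; case: eqP => [/(congr1 (fun m : 'X_{1..2} => m ord0))|_].
  by rewrite !bimon0 => /eqP; rewrite -val_eqE /= in ij *; rewrite ij.
by rewrite mulr0.
Qed.

Lemma size_dehomog n p : p \is n.-homog -> (size (dehomog p) <= n.+1)%N.
Proof.
move=> hp; rewrite -(dehomogK hp) /homogenise raddf_sum /=.
apply: (leq_trans (size_sum _ _ _)); apply/bigmax_leqP => j _.
by rewrite dehomogZ dehomog_mon bimon0 (leq_trans (size_scale_leq _ _)) ?size_polyXn.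
Qed.

Lemma dehomog_inj n p q : p \is n.-homog -> q \is n.-homog ->
  dehomog p = dehomog q -> p = q.
Proof. by move=> hp hq e; rewrite -(dehomogK hp) e dehomogK. Qed.

Lemma homog_X i : ('X_i : S) \is 1.-homog.
Proof. by rewrite dhomogX /= mdeg1. Qed.

Lemma homogXM e i (p : S) : p \is e.-homog -> 'X_i * p \is e.+1.-homog.
Proof. exact: dhomogM (homog_X i). Qed.

(** The only monomial not divisible by x is y^(e+1), so [q] can be a multiple of y^e given by the
    constant coefficient of the dehomogenisation. *)
Lemma homog_split e (u : S) : u \is e.+1.-homog ->
  exists p q : S, [/\ p \is e.-homog, q \is e.-homog & u = x * p + y * q].
Proof.
move=> hu; pose U := dehomog u; have sU := size_dehomog hu.
pose P := \poly_(j < e.+1) U`_j.+1.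
exists (homogenise e P), (homogenise e (U`_0)%:P); split; rewrite ?homogenise_homog //.
apply: (dehomog_inj hu); first by rewrite rpredD ?homogXM ?homogenise_homog.
rewrite rmorphD !rmorphM /= dehomogX0 dehomogX1 mul1r !homogeniseK ?size_poly ?(leq_trans (size_polyC_leq1 _)) //.
apply/polyP => j; rewrite coefD coefXM coefC; case: j => [|j] /=; rewrite ?add0r // addr0.
rewrite coef_poly; case: ltnP => // ej; rewrite nth_default //.
exact: leq_trans sU _.
Qed.

(** Exactness of the Koszul complex of x and y. With y = 1 the relation reads Q = - X P, so the size
    bound for Q improves the one for P by one, which means that y divides P. *)
Lemma syz_xy e (P Q : S) : P \is e.+1.-homog -> Q \is e.+1.-homog ->
  x * P + y * Q = 0 ->
  exists2 R : S, R \is e.-homog & P = y * R /\ Q = - (x * R).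
Proof.
move=> hP hQ E; have: dehomog (x * P + y * Q) = 0 by rewrite E raddf0.
rewrite rmorphD !rmorphM /= dehomogX0 dehomogX1 mul1r => /eqP; rewrite addrC addr_eq0 => /eqP E'.
have sP : (size (dehomog P) <= e.+1)%N.
  have [->|P0] := eqVneq (dehomog P) 0; first by rewrite size_poly0.
  have := size_dehomog hQ; rewrite E' size_polyN mulrC size_mulX //.
exists (homogenise e (dehomog P)); first exact: homogenise_homog.
split.
  apply: (dehomog_inj hP); first by rewrite homogXM ?homogenise_homog.
  by rewrite rmorphM /= dehomogX1 mul1r homogeniseK.
apply: (dehomog_inj hQ); first by rewrite rpredN homogXM ?homogenise_homog.
by rewrite rmorphN rmorphM /= dehomogX0 homogeniseK.
Qed.

Lemma pihomogM D e (u g : S) : g \is D.-homog ->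
  pihomog mdeg (e + D) (u * g) = pihomog mdeg e u * g.
Proof.
move=> hg; rewrite {1}(pihomog_partitionE (leqnn (mmeasure mdeg u))) mulr_suml raddf_sum /=.
rewrite [in RHS](pihomog_partitionE (leqnn (mmeasure mdeg u))) raddf_sum mulr_suml.
apply: eq_bigr => i _ /=; have hi := pihomogP mdeg i u.
have him := dhomogM hi hg.
have [ie|ie] := eqVneq (i : nat) e.
  by rewrite -ie (pihomog_dE him) (pihomog_dE hi).
rewrite (pihomog_ne0 _ him) ?eqn_add2r //.
by rewrite (pihomog_ne0 ie hi) mul0r.
Qed.

Lemma pihomogM_lt D e (u g : S) : g \is D.-homog -> (e < D)%N ->
  pihomog mdeg e (u * g) = 0.
Proof.
move=> hg eD; rewrite {1}(pihomog_partitionE (leqnn (mmeasure mdeg u))) mulr_suml raddf_sum /=.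
apply: big1 => i _; apply: (pihomog_ne0 _ (dhomogM (pihomogP mdeg i u) hg)).
by apply/eqP => E; move: eD; rewrite -E ltnNge leq_addl.
Qed.

End Dehomogenisation.

(** * Independence and spanning as rank conditions *)

Section CoefficientMatrix.

(** The ring [A] is general so that the entries may also be polynomials in the coefficients of the
    forms; rank conditions are then visibly open. *)
Definition coef_rows (A : nzRingType) (m n : nat) (q : 'I_m -> {poly A}) : 'M[A]_(m, n) :=
  \matrix_(i, j) (q i)`_j.

(** The dehomogenised products x q and y q, which span S_1 W when the q span W. *)
Definition mulX_rows (A : nzRingType) m (q : 'I_m -> {poly A}) (a : 'I_(m + m)) : {poly A} :=
  match split a with inl b => 'X * q b | inr b => q b end.

Variable K : fieldType.

Lemma mul_coef_rows m n (q : 'I_m -> {poly K}) (c : 'rV_m) :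
  c *m coef_rows n q = poly_rV (\sum_i c 0 i *: q i).
Proof.
apply/rowP => j; rewrite !mxE coef_sum; apply: eq_bigr => i _.
by rewrite !mxE coefZ.
Qed.

Lemma coef_rows_freeP m n (q : 'I_m -> {poly K}) : (forall i, size (q i) <= n)%N ->
  reflect (forall c : 'rV_m, \sum_i c 0 i *: q i = 0 -> c = 0) (row_free (coef_rows n q)).
Proof.
move=> sq; apply: (iffP idP) => [fr c c0|H].
  by apply: (row_free_inj fr); rewrite mul0mx mul_coef_rows c0 raddf0.
rewrite -kermx_eq0; apply/eqP/row_matrixP => i; rewrite row0; apply: H.
have sz : (size (\sum_j (row i (kermx (coef_rows n q))) 0 j *: q j)%R <= n)%N.
  apply: (leq_trans (size_sum _ _ _)); apply/bigmax_leqP => j _.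
  exact: leq_trans (size_scale_leq _ _) (sq j).
by rewrite -(poly_rV_K sz) -mul_coef_rows -row_mul mulmx_ker row0 raddf0.
Qed.

Lemma coef_rows_fullP m n (q : 'I_m -> {poly K}) : (forall i, size (q i) <= n)%N ->
  reflect (forall p : {poly K}, (size p <= n)%N -> exists c : 'rV_m, p = \sum_i c 0 i *: q i)
    (row_full (coef_rows n q)).
Proof.
move=> sq; have sz (c : 'rV_m) : (size (\sum_j c 0 j *: q j)%R <= n)%N.
  apply: (leq_trans (size_sum _ _ _)); apply/bigmax_leqP => j _.
  exact: leq_trans (size_scale_leq _ _) (sq j).
apply: (iffP idP) => [fu p sp|H].
  have /submxP[c cE] := submx_full (poly_rV p : 'rV_n) fu; exists c.
  by rewrite -(poly_rV_K sp) cE mul_coef_rows poly_rV_K.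
rewrite -sub1mx; apply/row_subP => i; have [|c cE] := H (rVpoly (row i 1%:M)).
  exact: size_poly.
by apply/submxP; exists c; rewrite mul_coef_rows -cE rVpolyK.
Qed.

End CoefficientMatrix.

(** Over a domain the syzygies of m + 1 elements, not all zero, have rank m, so m generators of them
    satisfy no relation. This gives exactness at the left end of the resolution. *)
Lemma syzygy_basis_inj (A : idomainType) m (g : 'cV[A]_m.+1) (T : 'M[A]_(m, m.+1)) :
    g != 0 -> (forall u : 'rV_m.+1, u *m g = 0 -> exists w, u = w *m T) ->
  forall w : 'rV_m, w *m T = 0 -> w = 0.
Proof.
move=> g0 gen w wT.
have [i0 gi0] : exists i, g i 0 != 0.
  by apply/existsP; apply: contraNT g0; rewrite negb_exists => /forallP g0;
     apply/eqP/colP => i; rewrite mxE; apply/eqP; have := g0 i; rewrite negbK.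
(* The Koszul syzygies g_i0 e_j - g_j e_i0 give C T' = g_i0 Id, with T' square. *)
have /fin_all_exists[C CE] : forall j : 'I_m, exists w : 'rV_m,
    g i0 0 *: delta_mx 0 (lift i0 j) - g (lift i0 j) 0 *: delta_mx 0 i0 = w *m T.
  move=> j; apply: gen; rewrite mulmxBl -!scalemxAl -!rowE.
  by apply/rowP => k; rewrite !mxE ord1 mulrC subrr.
pose T' := col' i0 T; pose C' := \matrix_j C j.
have CT : C' *m T' = (g i0 0)%:M.
  apply/matrixP => j k; have := congr1 (fun M : 'rV_m.+1 => M 0 (lift i0 k)) (CE j).
  rewrite !mxE !eqxx /= lift_eqF mulr0 subr0 (inj_eq (@lift_inj _ _)) => E.
  rewrite [k == j]eq_sym mulr_natr in E; rewrite E.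
  by apply: eq_bigr => l _; rewrite !mxE.
have dT : \det T' != 0.
  have := congr1 determinant CT; rewrite det_mulmx det_scalar => E.
  by apply: contraNneq (expf_neq0 m gi0) => d0; rewrite -E d0 mulr0.
have wT' : w *m T' = 0.
  apply/rowP => k; have := congr1 (fun M : 'rV_m.+1 => M 0 (lift i0 k)) wT.
  by rewrite !mxE => E; rewrite -[RHS]E; apply: eq_bigr => l _; rewrite !mxE.
have := congr1 (mulmx^~ (\adj T')) wT'; rewrite /= mul0mx -mulmxA mul_mx_adj mul_mx_scalar.
by move/eqP; rewrite scalemx_eq0 (negPf dT) => /eqP.
Qed.

(** * Linear algebra of W in S_D and of S_1 W in S_(D+1) *)

Section Resolution.
Variables (K : fieldType) (D N : nat).
Local Notation S := {mpoly K[2]}.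
Local Notation x := ('X_ord0 : S).
Local Notation y := ('X_ord_max : S).
Local Notation cst := (map_mx (@mpolyC 2 K)).

Definition homrow e m (u : 'rV[S]_m) := forall a, u 0 a \is e.-homog.

Lemma homrow0 e m : homrow e (0 : 'rV_m).
Proof. by move=> a; rewrite mxE rpred0. Qed.

Lemma homrowD e m (u v : 'rV_m) : homrow e u -> homrow e v -> homrow e (u + v).
Proof. by move=> hu hv a; rewrite mxE rpredD. Qed.

Lemma homrowN e m (u : 'rV_m) : homrow e u -> homrow e (- u).
Proof. by move=> hu a; rewrite mxE rpredN. Qed.

Lemma homrowX e m i (u : 'rV_m) : homrow e u -> homrow e.+1 ('X_i *: u).
Proof. by move=> hu a; rewrite mxE homogXM. Qed.

Lemma homrow_cst m (c : 'rV_m) : homrow 0 (cst c).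
Proof. by move=> a; rewrite mxE -[_%:MP]mulr1 mul_mpolyC rpredZ ?dhomog1. Qed.

Lemma homrow_mul e f m n (u : 'rV_m) (A : 'M_(m, n)) : homrow e u ->
  (forall i j, A i j \is f.-homog) -> homrow (e + f) (u *m A).
Proof. by move=> hu hA a; rewrite mxE rpred_sum // => i _; rewrite dhomogM. Qed.

Lemma homog0E (p : S) : p \is 0.-homog -> p = (p@_0%MM)%:MP.
Proof.
move=> hp; apply/mpolyP => m; rewrite mcoeffC; have [->|m0] := eqVneq m 0%MM.
  by rewrite mulr1.
by rewrite mulr0 (dhomog_nemf_coeff hp) //= mdeg_eq0.
Qed.

Lemma homrow0E m (u : 'rV_m) : homrow 0 u -> exists c, u = cst c.
Proof.
move=> hu; exists (map_mx (mcoeff 0%MM) u); apply/rowP => a.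
by rewrite !mxE [LHS]homog0E.
Qed.

Lemma homrow_split e m (u : 'rV_m) : homrow e.+1 u ->
  exists P Q, [/\ homrow e P, homrow e Q & u = x *: P + y *: Q].
Proof.
move=> hu; have /fin_all_exists[P HP] := fun a => homog_split (hu a).
have /fin_all_exists[Q HQ] := HP.
exists (\row_a P a), (\row_a Q a); split=> [a|a|]; rewrite ?mxE; try by case: (HQ a).
by apply/rowP => a; rewrite !mxE; case: (HQ a).
Qed.

Lemma dehomog_cst n m (c : 'rV_m) (h : 'M_(m, n)) j :
  dehomog ((cst c *m h) 0 j) = \sum_a c 0 a *: dehomog (h a j).
Proof.
rewrite mxE raddf_sum; apply: eq_bigr => a _ /=.
by rewrite mxE mul_mpolyC dehomogZ.
Qed.

Lemma mx11E (A : 'M[S]_1) h : A 0 0 = h -> A = h%:M.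
Proof. by move<-; apply: mx11_scalar. Qed.

Lemma mul_xy_row m (u v : 'rV[S]_m) (h : 'cV[S]_m) :
  ((x *: u + y *: v) *m h) 0 0 = x * (u *m h) 0 0 + y * (v *m h) 0 0.
Proof. by rewrite mulmxDl -!scalemxAl mxE; congr (_ + _); rewrite mxE. Qed.

Variable g : 'cV[S]_N.
Hypothesis hg : forall a, g a 0 \is D.-homog.
Local Notation G := (fun a => dehomog (g a 0)).
Hypothesis g_free : row_free (coef_rows D.+1 G).
Hypothesis g_full : row_full (coef_rows D.+2 (mulX_rows G)).

Lemma homrow_mulg e u : homrow e u -> (u *m g) 0 0 \is (e + D).-homog.
Proof. by move=> hu; rewrite (homrow_mul hu) // => i j; rewrite ord1. Qed.

Lemma size_g a : (size (G a) <= D.+1)%N.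
Proof. exact: size_dehomog. Qed.

Lemma size_xg a : (size (mulX_rows G a) <= D.+2)%N.
Proof.
rewrite /mulX_rows; case: split => b; last exact: leq_trans (size_g b) _.
by rewrite mulrC (leq_trans (size_polyMleq _ _)) // size_polyX addn2 /= ltnS size_g.
Qed.

Lemma syz0 u : homrow 0 u -> u *m g = 0 -> u = 0.
Proof.
move=> /homrow0E[c ->] /(congr1 (fun A : 'M_1 => dehomog (A 0 0))).
rewrite dehomog_cst mxE raddf0 => E.
by move/(coef_rows_freeP size_g): g_free => /(_ c E) ->; rewrite map_mx0.
Qed.

Lemma dehomog_xg (c : 'rV_(N + N)) :
  dehomog (((x *: cst (lsubmx c) + y *: cst (rsubmx c)) *m g) 0 0) =
  \sum_a c 0 a *: mulX_rows G a.
Proof.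
rewrite mul_xy_row rmorphD !rmorphM /= dehomogX0 dehomogX1 mul1r !dehomog_cst.
rewrite big_split_ord /= mulr_sumr; congr (_ + _); apply: eq_bigr => i _.
  by rewrite /mulX_rows (unsplitK (inl i)) mxE scalerAr.
by rewrite /mulX_rows (unsplitK (inr i)) mxE.
Qed.

Lemma span1 h : h \is D.+1.-homog ->
  exists P Q, [/\ homrow 0 P, homrow 0 Q & (x *: P + y *: Q) *m g = h%:M].
Proof.
move=> hh; have /(coef_rows_fullP size_xg)/(_ _ (size_dehomog hh))[c cE] := g_full.
exists (cst (lsubmx c)), (cst (rsubmx c)); split; try exact: homrow_cst.
apply: mx11E; apply: (dehomog_inj _ hh); last by rewrite dehomog_xg.
apply: (@homrow_mulg 1%N).
by apply: homrowD; apply: homrowX; apply: homrow_cst.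
Qed.

(** Since S_1 W = S_(D+1), splitting off x and y by induction puts every form of degree greater than
    D into (W). *)
Lemma spanS e h : h \is (e.+1 + D).-homog -> exists2 u, homrow e.+1 u & u *m g = h%:M.
Proof.
elim: e h => [|e IH] h hh.
  have [P [Q [hP hQ E]]] := span1 hh.
  by exists (x *: P + y *: Q) => //; apply: homrowD; apply: homrowX.
have [p [q [/IH[u hu uE] /IH[v hv vE] ->]]] := homog_split hh.
exists (x *: u + y *: v); first by apply: homrowD; apply: homrowX.
by rewrite mulmxDl -!scalemxAl uE vE !scale_scalar_mx raddfD.
Qed.

(** The forms [c] lift a basis of a complement of W in S_D. They represent the degree D part of
    S/(W), and each of them yields one quadratic syzygy. *)
Lemma complement_basis : exists n (c : 'cV[S]_n),
  [/\ (n + N = D.+1)%N, forall q, c q 0 \is D.-homog,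
      forall h, h \is D.-homog -> exists l u, homrow 0 u /\ cst l *m c + u *m g = h%:M
    & forall l u, homrow 0 u -> cst l *m c = u *m g -> l = 0].
Proof.
pose M := coef_rows D.+1 G; pose B := row_base (M^C)%MS.
pose c := \col_q homogenise D (rVpoly (row q B)).
have hc q : c q 0 \is D.-homog by rewrite mxE homogenise_homog.
have cE l : poly_rV (dehomog ((cst l *m c) 0 0)) = l *m B.
  rewrite dehomog_cst; under eq_bigr do rewrite mxE homogeniseK ?size_poly //.
  rewrite raddf_sum /= mulmx_sum_row; apply: eq_bigr => q _.
  by rewrite linearZ /= rVpolyK.
have gE m : poly_rV (dehomog ((cst m *m g) 0 0)) = m *m M.
  by rewrite dehomog_cst mul_coef_rows.
exists _, c; split=> //.
- by rewrite mxrank_compl (eqP g_free) subnK // -(eqP g_free) rank_leq_col.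
- move=> h hh; have := addsmx_compl_full M; rewrite -sub1mx => /(submx_trans (submx1 _)).
  move=> /(_ _ (poly_rV (dehomog h))) /sub_addsmxP[[m l] /= E].
  have /submxP[l' l'E] : (l *m M^C <= B)%MS by rewrite eq_row_base submxMl.
  exists l', (cst m); split; first exact: homrow_cst.
  apply: mx11E; have hs : (cst l' *m c + cst m *m g) 0 0 \is D.-homog.
    rewrite mxE rpredD //; last exact: (homrow_mulg (homrow_cst m)).
    by apply: (homrow_mul (homrow_cst l')) => i j; rewrite ord1.
  apply: (dehomog_inj hs hh).
  rewrite -[LHS](poly_rV_K (size_dehomog hs)) -[RHS](poly_rV_K (size_dehomog hh)).
  by rewrite E mxE !raddfD /= cE gE addrC l'E.
- move=> l u /homrow0E[m ->] /(congr1 (fun A : 'M_1 => poly_rV (dehomog (A 0 0)) : 'rV_D.+1)).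
  rewrite cE gE => E; have : (l *m B <= M :&: M^C)%MS.
    by rewrite sub_capmx {1}E submxMl -(eq_row_base (M^C)%MS) submxMl.
  rewrite capmx_compl submx0 => /eqP lB; apply: (row_free_inj (row_base_free (M^C)%MS)).
  by rewrite lB mul0mx.
Qed.

(** Linear syzygies form the kernel of the multiplication map from two copies of W, one for x and
    one for y, onto S_(D+1); hence the dimension 2 N - (D + 2). *)
Lemma linear_syzygies : exists n (s : 'M[S]_(n, N)),
  [/\ (n + D.+2 = N + N)%N, forall i a, s i a \is 1.-homog, s *m g = 0
    & forall u, homrow 1 u -> u *m g = 0 -> exists w, u = w *m s].
Proof.
pose M := coef_rows D.+2 (mulX_rows G); pose B := row_base (kermx M).
pose s := x *: cst (lsubmx B) + y *: cst (rsubmx B).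
have sE w : cst w *m s = x *: cst (lsubmx (w *m B)) + y *: cst (rsubmx (w *m B)).
  by rewrite mulmxDr -!scalemxAr -!map_mxM -mulmx_lsub -mulmx_rsub.
have hs i a : s i a \is 1.-homog.
  have h (C : 'M_(_, N)) j : 'X_j * (cst C) i a \is 1.-homog.
    rewrite homogXM //; have := homrow_cst (row i C) a; by rewrite !mxE.
  by have := rpredD (h (lsubmx B) ord0) (h (rsubmx B) ord_max); rewrite !mxE.
exists _, s; split=> //.
- have rM : \rank M = D.+2 := eqP g_full.
  by rewrite mxrank_ker rM subnK // -[X in (X <= _)%N]rM rank_leq_row.
- apply/row_matrixP => i; rewrite row0 row_mul.
  have -> : row i s = cst (delta_mx 0 i) *m s by rewrite map_delta_mx -rowE.
  rewrite sE -[RHS](_ : (0 : S)%:M = _); last by rewrite raddf0.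
  set v := delta_mx 0 i *m B.
  have hr : ((x *: cst (lsubmx v) + y *: cst (rsubmx v)) *m g) 0 0 \is D.+1.-homog.
    by apply: (@homrow_mulg 1%N); apply: homrowD; apply: homrowX; apply: homrow_cst.
  apply: mx11E; apply: (dehomog_inj hr (rpred0 _)); rewrite raddf0.
  rewrite -(poly_rV_K (size_dehomog hr)) dehomog_xg -mul_coef_rows -/M.
  have /sub_kermxP -> : (v <= kermx M)%MS.
    by rewrite -(eq_row_base (kermx M)) submxMl.
  by rewrite raddf0.
- move=> u hu; have [P [Q [/homrow0E[p ->] /homrow0E[q ->] ->]]] := homrow_split hu.
  move=> /(congr1 (fun A : 'M_1 => dehomog (A 0 0))); rewrite [in RHS]mxE raddf0.
  have := dehomog_xg (row_mx p q); rewrite row_mxKl row_mxKr => -> E.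
  have : (row_mx p q <= B)%MS.
    by rewrite eq_row_base; apply/sub_kermxP; rewrite mul_coef_rows E raddf0.
  by move=> /submxP[w wE]; exists (cst w); rewrite sE -wE row_mxKl row_mxKr.
Qed.

End Resolution.

(** In x p + y q, the pair (p, q) may be changed by the Koszul pair (y r, - x r) at no cost; the
    pair (a, b) accounts for the quadratic syzygies that are subtracted. *)
Lemma koszul_shift (A : comNzRingType) (V : lmodType A) (x y : A) (p q a b r : V) :
  x *: p + y *: q = x *: (p - a - y *: r) + y *: (q - b + x *: r) + (x *: a + y *: b).
Proof.
rewrite scalerBr (scalerDr y) !scalerA (mulrC y x).
rewrite [X in _ = X + _]addrACA addNr addr0 !scalerBr.
by rewrite [in RHS]addrACA !subrK.
Qed.

(** * Generators of the syzygy module *)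

Section MinimalResolution.
Variables (K : fieldType) (D N : nat).
Local Notation S := {mpoly K[2]}.
Local Notation x := ('X_ord0 : S).
Local Notation y := ('X_ord_max : S).
Local Notation cst := (map_mx (@mpolyC 2 K)).
Variable g : 'cV[S]_N.
Local Notation G := (fun a => dehomog (g a 0)).
Hypothesis hg : forall a, g a 0 \is D.-homog.
Hypothesis g_free : row_free (coef_rows D.+1 G).
Hypothesis g_full : row_full (coef_rows D.+2 (mulX_rows G)).

(** All entries of [g] have the same degree, so every homogeneous component of a syzygy is itself a
    syzygy. *)
Lemma homog_syzygies_span n (T : 'M[S]_(n, N)) :
    (forall e (u : 'rV_N), homrow e u -> u *m g = 0 -> exists w, u = w *m T) ->
  forall u : 'rV_N, u *m g = 0 -> exists w, u = w *m T.
Proof.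
move=> HT u ug; pose B := (\max_a msize (u 0%R a))%N.
pose U (e : 'I_B) : 'rV[S]_N := map_mx (pihomog mdeg e) u.
have uE : u = \sum_e U e.
  apply/rowP => a; rewrite summxE; under eq_bigr do rewrite mxE.
  by apply: pihomog_partitionE; apply: leq_bigmax.
have /fin_all_exists[w wE] : forall e, exists w, U e = w *m T.
  move=> e; apply: (HT e) => [a|]; first by rewrite mxE; apply: pihomogP.
  apply: (etrans (mx11E (erefl _))); rewrite (_ : _ 0 0 = pihomog mdeg (e + D) ((u *m g) 0 0)).
    by rewrite ug mxE !raddf0.
  rewrite !mxE raddf_sum; apply: eq_bigr => a _ /=.
  by rewrite (pihomogM _ _ (hg a)) mxE.
by exists (\sum_e w e); rewrite mulmx_suml uE; apply: eq_bigr => e _; rewrite wE.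
Qed.

(** Induction on the degree of a syzygy: degrees 0 and 1 are linear algebra, and a syzygy of degree
    e + 2 is reduced to two syzygies of degree e + 1. *)
Lemma syzygy_basis : exists b c (s : 'M[S]_(b, N)) (t : 'M[S]_(c, N)),
  [/\ (b + D.+2 = N + N)%N, (c + N = D.+1)%N,
      (forall i a, s i a \is 1.-homog) /\ (forall i a, t i a \is 2.-homog),
      col_mx s t *m g = 0
    & forall u : 'rV_N, u *m g = 0 -> exists w, u = w *m col_mx s t].
Proof.
have [c [C [cN hC Cspan Cind]]] := complement_basis hg g_free.
have [b [s [bN hs sg slin]]] := linear_syzygies hg g_full.
(* t_q = x P_q + y Q_q, where P_q . g = y C_q and Q_q . g = - x C_q *)
have exY i q : exists2 u, homrow 1 u & u *m g = ('X_i * C q 0)%:M.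
  by apply: (spanS hg g_full (e := 0)); rewrite homogXM.
have /fin_all_exists2[P0 hP PE] := exY ord_max.
have /fin_all_exists2[Q0 hQ QE] := exY ord0.
pose P := \matrix_q P0 q; pose Q := - \matrix_q Q0 q.
have Pg : P *m g = y *: C.
  apply/row_matrixP => q; rewrite row_mul rowK PE linearZ /=.
  by apply/rowP => j; rewrite !mxE ord1 mulr1n.
have Qg : Q *m g = - (x *: C).
  rewrite mulNmx; congr (- _); apply/row_matrixP => q; rewrite row_mul rowK QE linearZ /=.
  by apply/rowP => j; rewrite !mxE ord1 mulr1n.
have hP1 i j : P i j \is 1.-homog by rewrite mxE hP.
have hQ1 i j : Q i j \is 1.-homog by rewrite !mxE rpredN hQ.
pose t := x *: P + y *: Q; exists b, c, s, t.
have tg : t *m g = 0.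
  by rewrite mulmxDl -!scalemxAl Pg Qg scalerN !scalerA mulrC subrr.
split=> //; first by split=> // i a; rewrite mxE rpredD // mxE homogXM.
  by rewrite mul_col_mx sg tg col_mx0.
(* The complement is needed only in degree D; above it, every form lies in (W) and [l] is 0. *)
have colon e h : h \is (e + D).-homog -> exists l u,
    [/\ homrow e u, (e != 0)%N -> l = 0 & cst l *m C + u *m g = h%:M].
  case: e => [|e] hh; first by have [l [u [hu E]]] := Cspan h hh; exists l, u.
  by have [u hu E] := spanS hg g_full hh; exists 0, u; rewrite map_mx0 mul0mx add0r.
apply: homog_syzygies_span => e; elim: e => [|[|e] IH] u hu ug.
- by exists 0; rewrite mul0mx (syz0 hg g_free hu).
- by have [w ->] := slin u hu ug; exists (row_mx w 0); rewrite mul_row_col mul0mx addr0.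
have [p [q [hp hq uE]]] := homrow_split hu.
have [R hR [pg qg]] : exists2 R : S, R \is (e + D).-homog &
    (p *m g) 0 0 = y * R /\ (q *m g) 0 0 = - (x * R).
  apply: syz_xy; [exact: (homrow_mulg hg hp)|exact: (homrow_mulg hg hq)|].
  by rewrite -mul_xy_row -uE ug mxE.
have [l [r [hr l0 lE]]] := colon e R hR.
(* The product has degree 1, which is the right degree for e = 0; for e > 0 it is zero. *)
have hl (A : 'M_(c, N)) : (forall i j, A i j \is 1.-homog) -> homrow e.+1 (cst l *m A).
  move=> hA; case: (e) l0 => [_|n ->] //.
    exact: (homrow_mul (homrow_cst l) hA).
  by rewrite map_mx0 mul0mx; apply: homrow0.
(* As R = l C + r g, the terms l P and y r contribute y (l C) and y (r g), which together cancel p g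
   = y R. The same works for [q] with factor - x. *)
have [w1 w1E] : exists w, p - cst l *m P - y *: r = w *m col_mx s t.
  apply: IH; first by apply: homrowD; [apply: homrowD => //|]; apply: homrowN;
    [apply: hl | apply: homrowX].
  rewrite !mulmxBl -mulmxA Pg -scalemxAr -scalemxAl -addrA -opprD -scalerDr lE.
  by rewrite [p *m g]mx11_scalar pg scale_scalar_mx subrr.
have [w2 w2E] : exists w, q - cst l *m Q + x *: r = w *m col_mx s t.
  apply: IH; first by apply: homrowD; [apply: homrowD => //|]; [apply: homrowN;
    apply: hl | apply: homrowX].
  rewrite mulmxDl mulmxBl -mulmxA Qg mulmxN opprK -scalemxAr -scalemxAl -addrA -scalerDr lE.
  by rewrite [q *m g]mx11_scalar qg scale_scalar_mx raddfN addNr.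
exists (x *: w1 + y *: w2 + row_mx 0 (cst l)).
rewrite !mulmxDl -!scalemxAl -w1E -w2E mul_row_col mul0mx add0r uE /t.
by rewrite mulmxDr -!scalemxAr -koszul_shift.
Qed.

End MinimalResolution.

(** * Hilbert function and Betti numbers of S/(W) *)

Section HilbertBetti.
Variables (K : fieldType) (D N : nat).
Local Notation S := {mpoly K[2]}.
Local Notation cst := (map_mx (@mpolyC 2 K)).
Variable g : 'cV[S]_N.
Local Notation G := (fun a => dehomog (g a 0)).
Hypothesis hg : forall a, g a 0 \is D.-homog.
Hypothesis g_free : row_free (coef_rows D.+1 G).
Hypothesis g_full : row_full (coef_rows D.+2 (mulX_rows G)).
Variable I : S -> Prop.
Hypothesis Ig : forall p, I p <-> exists u : 'rV_N, p = (u *m g) 0 0.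

Lemma g_neq0 : g != 0.
Proof.
apply: contraTneq g_full => ->; rewrite /row_full (_ : coef_rows _ _ = 0) ?mxrank0 //.
apply/matrixP => a j; rewrite !mxE /mulX_rows.
by case: split => i; rewrite !mxE raddf0 ?mulr0 coef0.
Qed.

Lemma pihomog_mulg e (u : 'rV_N) :
  pihomog mdeg (e + D) ((u *m g) 0 0) = (map_mx (pihomog mdeg e) u *m g) 0 0.
Proof.
rewrite !mxE raddf_sum; apply: eq_bigr => a _ /=.
by rewrite mxE (pihomogM _ _ (hg a)).
Qed.

Lemma ideal_lt n (p : S) : I p -> p \is n.-homog -> (n < D)%N -> p = 0.
Proof.
move=> /Ig[u ->] hp nD; rewrite -(pihomog_dE hp) mxE raddf_sum big1 // => a _.
exact: pihomogM_lt (hg a) nD.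
Qed.

Lemma ideal_homog n (p : S) : I p -> p \is (n + D).-homog ->
  exists2 u, homrow n u & p = (u *m g) 0 0.
Proof.
move=> /Ig[u ->] hp; rewrite -(pihomog_dE hp) pihomog_mulg.
by exists (map_mx (pihomog mdeg n) u) => // a; rewrite mxE pihomogP.
Qed.

Lemma ideal0 : I 0.
Proof. by apply/Ig; exists 0; rewrite mul0mx mxE. Qed.

Lemma sum_bimon_homog n (c : 'I_n.+1 -> K) :
  \sum_i c i *: 'X_[bimon n i] \is n.-homog.
Proof.
by apply: rpred_sum => i _; rewrite rpredZ // dhomogX /= mdeg_bimon // -ltnS.
Qed.

Lemma hilbert_lt n : (n < D)%N -> quot_dim (fun p : S => p \is n.-homog) I n.+1.
Proof.
move=> nD; exists (fun j => 'X_[bimon n j]); split=> [j|c Ic i|p hp].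
- by rewrite dhomogX /= mdeg_bimon // -ltnS.
- have := ideal_lt Ic (sum_bimon_homog c) nD => /(congr1 (mcoeff (bimon n i))).
  rewrite mcoeff0 raddf_sum (bigD1 i) //= mcoeffZ mcoeffX eqxx mulr1 big1 ?addr0 //.
  move=> j /negPf ji; rewrite mcoeffZ mcoeffX; case: eqP => [/(congr1 (fun m : 'X_{1..2} => m ord0))|_].
    by rewrite !bimon0 => /val_inj/eqP; rewrite ji.
  by rewrite mulr0.
- exists (fun j => (dehomog p)`_j).
  by rewrite -[X in X - _](dehomogK hp) /homogenise subrr; apply: ideal0.
Qed.

Lemma hilbert_eq n : (n + N = D.+1)%N -> quot_dim (fun p : S => p \is D.-homog) I n.
Proof.
have [m [c [mN hc span ind]]] := complement_basis hg g_free.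
rewrite -mN => /addIn ->; exists (fun q => c q 0).
have sumE (l : 'I_m -> K) : \sum_i l i *: c i 0 = (cst (\row_i l i) *m c) 0 0.
  by rewrite mxE; apply: eq_bigr => i _; rewrite !mxE mul_mpolyC.
split=> // [l Il i|p hp].
  have hs : \sum_i l i *: c i 0 \is (0 + D).-homog.
    by apply: rpred_sum => j _; apply: rpredZ.
  have [u hu E] := ideal_homog Il hs.
  have := ind (\row_i l i) u hu; rewrite [_ *m c]mx11_scalar -sumE E -mx11_scalar => /(_ erefl).
  by move/rowP/(_ i); rewrite !mxE.
have [l [u [hu E]]] := span p hp; exists (fun i => l 0 i); rewrite sumE; apply/Ig; exists u.
have := congr1 (fun A : 'M_1 => A 0 0) E; rewrite mxE [RHS]mxE mulr1n => <-.
rewrite (_ : \row_i l 0 i = l); first by rewrite addrAC subrr add0r.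
by apply/rowP => i; rewrite mxE.
Qed.

Lemma hilbert_gt n : (D < n)%N -> quot_dim (fun p : S => p \is n.-homog) I 0.
Proof.
move=> Dn; exists (fun=> 0); split=> [i|c _ []//|p hp]; first exact: rpred0.
exists (fun=> 0); rewrite big_ord0 subr0.
have [e nE] : exists e, n = (e.+1 + D)%N by exists (n - D.+1)%N; lia.
rewrite nE in hp; have [u _ E] := spanS hg g_full hp.
by apply/Ig; exists u; rewrite E mxE.
Qed.

(** In a minimal resolution the Tor cycles of given degree form a coordinate subspace and the
    boundaries vanish. *)
Lemma quot_dim_coord m (P : pred 'I_m) (A B : 'rV[K]_m -> Prop) :
    (forall v, A v <-> forall b, v 0 b != 0 -> P b) -> (forall v, B v <-> v = 0) ->
  quot_dim A B #|P|.
Proof.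
move=> AP B0; pose e (i : 'I_#|P|) : 'rV[K]_m := delta_mx 0 (enum_val i); exists e.
have sumE (c : 'I_#|P| -> K) b :
    (\sum_i c i *: e i) 0 b = \sum_(i | enum_val i == b) c i :> K.
  rewrite summxE [RHS]big_mkcond; apply: eq_bigr => i _; rewrite !mxE eq_sym.
  by rewrite eqxx; case: eqP; rewrite ?mulr1 ?mulr0.
split=> [i|c /B0 E i|v /AP Av].
- apply/AP => b; rewrite mxE /=; case: (b =P enum_val i) => [-> _|_]; last by rewrite eqxx.
  exact: enum_valP.
- have := sumE c (enum_val i); rewrite E mxE.
  by rewrite (big_pred1 i) // => j; rewrite (inj_eq enum_val_inj).
- exists (fun i => v 0 (enum_val i)); apply/B0/rowP => b; rewrite mxE [X in _ + X]mxE sumE mxE.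
  have [Pb|nPb] := boolP (P b).
    rewrite (big_pred1 (enum_rank_in Pb b)) => [|j]; first by rewrite enum_rankK_in ?subrr.
    apply/eqP/eqP => [jb|->]; last by rewrite enum_rankK_in.
    by apply: enum_val_inj; rewrite enum_rankK_in.
  rewrite big1 => [|j /eqP jb]; last by move: (enum_valP j); rewrite jb unfold_in (negPf nPb).
  by rewrite subr0; apply/eqP; apply: contraNT nPb => /Av.
Qed.

(** Minimality kills all differentials after tensoring with K, so Tor is read off from the
    shifts. *)
Lemma betti_minimal (F : graded_free K 2) : is_resolution F I -> (forall i, dif0 F i = 0) ->
  forall i j, graded_betti I i j #|[pred b : 'I_(rk F i) | sh b == j]|.
Proof.
move=> Fres F0 i j; exists F; split=> //; apply: quot_dim_coord => v.
  have deg : in_degree j v <-> (forall b, v 0 b != 0 -> [pred b | sh b == j] b).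
    by split=> h b /h /eqP.
  rewrite -deg; case: i v {deg} => [|i] v //=.
  by rewrite F0 mulmx0; split=> [[]|].
rewrite /tor_boundary F0; split=> [[w [_ ->]]|->]; first exact: mulmx0.
by exists 0; rewrite mulmx0; split=> // b; rewrite mxE eqxx.
Qed.

Section Complex.
Variables (b c : nat) (s : 'M[S]_(b, N)) (t : 'M[S]_(c, N)).

(** With [shift2] and [diff2] this encodes the Hilbert-Burch complex 0 -> S(-D-1)^b + S(-D-2)^c ->
    S(-D)^N -> S, padded by zero modules. *)
Definition rank2 (i : nat) : nat :=
  match i with 0 => 1 | 1 => N | 2 => b + c | _ => 0 end.

Definition shift2 (i : nat) : 'I_(rank2 i) -> nat :=
  match i return 'I_(rank2 i) -> nat with
  | 0 => fun=> 0
  | 1 => fun=> D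
  | 2 => fun a => match split a with inl _ => D.+1 | inr _ => D.+2 end
  | _ => fun=> 0
  end%N.

Definition diff2 (i : nat) : 'M[S]_(rank2 i.+1, rank2 i) :=
  match i return 'M[S]_(rank2 i.+1, rank2 i) with
  | 0 => g
  | 1 => col_mx s t
  | _ => 0
  end.

Definition complex2 : graded_free K 2 := GradedFree shift2 diff2 1.

End Complex.

Lemma graded_betti_ideal b c : (0 < D)%N -> (b + D.+2 = N + N)%N -> (c + N = D.+1)%N ->
  [/\ graded_betti I 0 0 1, graded_betti I 1 D N, graded_betti I 2 D.+1 b,
      graded_betti I 2 D.+2 c
    & forall i j, (i, j) \notin [:: (0, 0); (1, D); (2, D.+1); (2, D.+2)]%N ->
        graded_betti I i j 0].
Proof.
move=> D0; have [b' [c' [s [t [bN cN [hs ht] stg gen]]]]] := syzygy_basis hg g_free g_full.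
move=> bN' cN'; have -> : b = b' by lia.
have -> : c = c' by lia.
(* The two counts give b' + c' = N - 1, as [syzygy_basis_inj] requires. Since N occurs in types, the
   matrices are generalised before it is rewritten. *)
have inj (w : 'rV_(b' + c')) : w *m col_mx s t = 0 -> w = 0.
  have NE : N = (b' + c').+1 by lia.
  move: (g) (col_mx s t) w g_neq0 gen; rewrite NE => h T w h0 hgen.
  exact: syzygy_basis_inj hgen w.
pose F := complex2 s t.
have Fres : is_resolution F I.
  split.
  - split=> [i|]; first by rewrite mxE ord1; apply: dhomog1.
    case=> [|[|i]] /=.
    + move=> a j; rewrite subn0 ltn0 ord1; split=> // _; exact: hg.
    + move=> a j; rewrite mxE; case: (split a) => k.
        by split=> [_|]; rewrite ?subSnn // ltnNge leqnSn.
      by split=> [_|]; rewrite ?(subSn (leqnSn _)) ?subSnn // ltnNge ltnW.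
    + by move=> [].
  - by move=> p; exists p%:M; rewrite mulmx1 mxE subrr; apply: ideal0.
  - move=> u; rewrite mulmx1 Ig; split=> -[w E]; exists w; last by rewrite E.
    by apply/rowP => j; rewrite ord1 E.
  - case=> [|[|i]] /= u.
    + split=> [/gen//|[w ->]]; by rewrite -mulmxA stg mulmx0.
    + by split=> [/inj ->|[w ->]]; [exists 0 | ]; rewrite ?mulmx0 ?mul0mx.
    + by split=> _; [exists 0; rewrite mulmx0; apply: thinmx0 | apply: mulmx0].
(* The nonzero differentials have entries of degrees D, 1 and 2, all positive, so no constant
   coefficient survives. *)
have F0 i : dif0 F i = 0.
  have z e (p : S) : p \is e.-homog -> (0 < e)%N -> p@_0%MM = 0.
    by move=> hp e0; apply: (dhomog_nemf_coeff hp); rewrite /= mdeg0 eq_sym -lt0n.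
  apply/matrixP => a j; rewrite !mxE; case: i a j => [|[|i]] /= a j.
  - by rewrite ord1; apply: z (hg a) D0.
  - by rewrite mxE; case: split => k; [apply: z (hs k j) _ | apply: z (ht k j) _].
  - by rewrite mxE mcoeff0.
have B := betti_minimal Fres F0.
have card2 j : #|[pred a : 'I_(rk F 2) | sh a == j]| =
    (b' * (D.+1 == j) + c' * (D.+2 == j))%N.
  have shl i : sh (g := F) (i := 2) (lshift c' i) = D.+1 by rewrite /= (unsplitK (inl i)).
  have shr i : sh (g := F) (i := 2) (rshift b' i) = D.+2 by rewrite /= (unsplitK (inr i)).
  rewrite -sum1_card big_mkcond big_split_ord; congr (_ + _)%N.
    under eq_bigr => i _ do rewrite inE shl.
    by rewrite big_const_ord iter_addn_0 mulnC; case: eqP.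
  under eq_bigr => i _ do rewrite inE shr.
  by rewrite big_const_ord iter_addn_0 mulnC; case: eqP.
have card1 j : #|[pred a : 'I_(rk F 1) | sh a == j]| = (N * (D == j))%N.
  by rewrite -sum1_card big_mkcond /= big_const_ord iter_addn_0 mulnC; case: eqP.
have card0 j : #|[pred a : 'I_(rk F 0) | sh a == j]| = (0 == j)%N :> nat.
  by rewrite -sum1_card big_mkcond /= big_const_ord iter_addn_0 mulnC; case: eqP.
split.
- by have := B 0 0; rewrite card0.
- by have := B 1 D; rewrite card1 eqxx muln1.
- by have := B 2 D.+1; rewrite card2 eqxx muln1 (gtn_eqF (leqnn _)) muln0 addn0.
- by have := B 2 D.+2; rewrite card2 eqxx muln1 (ltn_eqF (leqnn _)) muln0 add0n.
- move=> [|[|[|i]]] j; rewrite !inE !xpair_eqE /= ?orbF ?andbF.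
  + by move=> j0; have := B 0 j; rewrite card0 eq_sym (negPf j0).
  + by move=> j0; have := B 1 j; rewrite card1 eq_sym (negPf j0) muln0.
  + rewrite negb_or => /andP[/negPf j1 /negPf j2]; have := B 2 j.
    by rewrite card2 ![_ == j]eq_sym j1 j2 !muln0.
  + by have := B i.+3 j; rewrite (eq_card0 (A := _)) // => -[].
Qed.

End HilbertBetti.

(** * Products of k forms with bounded exponent of the third *)

Section TernaryMonomials.

(** The pair (l, i) stands for f1^i f2^(k-l-i) f3^l; the type of l encodes the bound l < d. *)
Definition red_idx (d k : nat) : {set 'I_d * 'I_k.+1} :=
  [set z : 'I_d * 'I_k.+1 | (z.1 + z.2 <= k)%N].

Definition red_mon (A : comNzRingType) (d k : nat) (q0 q1 q2 : A) (a : 'I_#|red_idx d k|) : A :=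
  let z := enum_val a in q0 ^+ z.2 * q1 ^+ (k - (z.1 + z.2)) * q2 ^+ z.1.

Lemma rmorph_red_mon (A B : comNzRingType) (f : {rmorphism A -> B}) d k q0 q1 q2
  (a : 'I_#|red_idx d k|) :
  f (red_mon q0 q1 q2 a) = red_mon (f q0) (f q1) (f q2) a.
Proof. by rewrite /red_mon !rmorphM !rmorphXn. Qed.

(** Each l < d admits k + 1 - l values of i. As l <= d - 1 <= k + 1, no difference is truncated, and
    the sum is arithmetic. *)
Lemma card_red_idx d k : (0 < d)%N -> (d - 2 <= k)%N -> (#|red_idx d k| + 'C(d - 1, 2) = (d * k).+1)%N.
Proof.
have -> : #|red_idx d k| = (\sum_(l < d) (k.+1 - l))%N.
  rewrite -sum1_card (eq_bigl (fun z : 'I_d * 'I_k.+1 => true && (z.1 + z.2 <= k)%N)); last first.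
    by move=> z; rewrite inE.
  rewrite -(pair_big_dep xpredT (fun (l : 'I_d) (i : 'I_k.+1) => l + i <= k)%N (fun _ _ => 1%N)) /=.
  apply: eq_bigr => l _; rewrite (eq_bigl (fun i : 'I_k.+1 => (i < k.+1 - l)%N)).
    by rewrite -(big_ord_widen _ (fun=> 1%N) (leq_subr l k.+1)) sum1_card card_ord.
  by move=> i; apply/idP/idP; lia.
case: d => // d _; elim: d => [|d IH] dk.
  by rewrite big_ord1 subn0 mul1n addn0.
have {}IH := IH (leq_trans (leq_sub2r 2 (leqnSn d.+1)) dk).
by rewrite big_ord_recr; move: IH; rewrite !subn1 /= binS bin1; lia.
Qed.

End TernaryMonomials.

(** * Linear spans *)

Section LinearSpan.
Variables (K : fieldType) (V : lmodType K).

(** An inductive predicate, so that spans are transported along linear maps by induction, without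
    families of coefficients. *)
Inductive lin_span (P : V -> Prop) : V -> Prop :=
| lin_span0 : lin_span P 0
| lin_span_gen v of P v : lin_span P v
| lin_spanD v w of lin_span P v & lin_span P w : lin_span P (v + w)
| lin_spanZ a v of lin_span P v : lin_span P (a *: v).

Lemma lin_span_sum (P : V -> Prop) (I : Type) (r : seq I) (Q : pred I) (F : I -> V) :
  (forall i, Q i -> lin_span P (F i)) -> lin_span P (\sum_(i <- r | Q i) F i).
Proof. by move=> H; apply: big_ind => //; [apply: lin_span0 | apply: lin_spanD]. Qed.

Lemma lin_span_family (P : V -> Prop) m (e : 'I_m -> V) v :
    (forall w, P w -> exists i, w = e i) -> lin_span P v ->
  exists c : 'rV[K]_m, v = \sum_i c 0 i *: e i.
Proof.
move=> He; elim=> [|w /He[i ->]|w1 w2 _ [c1 ->] _ [c2 ->]|a w _ [c ->]].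
- by exists 0; rewrite big1 // => i _; rewrite mxE scale0r.
- exists (delta_mx 0 i); rewrite (bigD1 i) //= mxE !eqxx scale1r big1 ?addr0 // => j /negPf ji.
  by rewrite mxE ji andbF scale0r.
- by exists (c1 + c2); rewrite -big_split; apply: eq_bigr => i _; rewrite mxE scalerDl.
- by exists (a *: c); rewrite scaler_sumr; apply: eq_bigr => i _; rewrite mxE scalerA.
Qed.

Lemma lin_span_linear (P Q : V -> Prop) (f : V -> V) : linear f ->
  (forall w, P w -> lin_span Q (f w)) -> forall v, lin_span P v -> lin_span Q (f v).
Proof.
move=> lf; pose g : {linear V -> V} := HB.pack f (GRing.isLinear.Build _ _ _ _ f lf).
rewrite -[f]/(g : V -> V) => H v; elim=> [|w /H//|w1 w2 _ h1 _ h2|a w _ h].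
- by rewrite linear0; apply: lin_span0.
- by rewrite linearD; apply: lin_spanD.
- by rewrite linearZ; apply: lin_spanZ.
Qed.

End LinearSpan.

(** * Reduction by the implicit equation of the parametrised curve *)

Section Reduction.
Variables (K : fieldType) (q0 q1 q2 : {poly K}).

Definition is_mon b n (p : {poly K}) : Prop := exists i j l,
  [/\ (l < b)%N, (i + j + l = n)%N & p = q0 ^+ i * q1 ^+ j * q2 ^+ l].

Lemma mulr_linear (q : {poly K}) : linear ( *%R q).
Proof. by move=> a u v; rewrite mulrDr scalerAr. Qed.

Lemma span_mul0 b n p : lin_span (is_mon b n) p -> lin_span (is_mon b n.+1) (q0 * p).
Proof.
apply: (lin_span_linear (mulr_linear q0)) => {p} _ [i [j [l [lb <- ->]]]]; apply: lin_span_gen.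
by exists i.+1, j, l; split=> //; rewrite exprS !mulrA.
Qed.

Lemma span_mul1 b n p : lin_span (is_mon b n) p -> lin_span (is_mon b n.+1) (q1 * p).
Proof.
apply: (lin_span_linear (mulr_linear q1)) => {p} _ [i [j [l [lb <- ->]]]]; apply: lin_span_gen.
by exists i, j.+1, l; split=> //; [lia | rewrite exprS; ring].
Qed.

Lemma span_mul2 b n p : lin_span (is_mon b n) p -> lin_span (is_mon b.+1 n.+1) (q2 * p).
Proof.
apply: (lin_span_linear (mulr_linear q2)) => {p} _ [i [j [l [lb <- ->]]]]; apply: lin_span_gen.
by exists i, j, l.+1; split=> //; [lia | rewrite exprS; ring].
Qed.

Lemma span_widen b b' n p : (b <= b')%N -> lin_span (is_mon b n) p -> lin_span (is_mon b' n) p.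
Proof.
move=> bb'; apply: (@lin_span_linear _ _ _ _ id) => [a u v //|{p} _ [i [j [l [lb <- ->]]]]].
by apply: lin_span_gen; exists i, j, l; split=> //; apply: leq_trans bb'.
Qed.

(** The coefficients form the Sylvester matrix, whose full rank says that S_(2d-1) = f1 S_(d-1) + f2
    S_(d-1). *)
Definition sylvester_rows (A : comNzRingType) d (p0 p1 : {poly A}) (a : 'I_(d + d)) : {poly A} :=
  match split a with inl j => 'X^j * p0 | inr j => 'X^j * p1 end.

Variable d : nat.
Hypotheses (d_gt0 : (0 < d)%N) (sq0 : (size q0 <= d.+1)%N) (sq1 : (size q1 <= d.+1)%N)
  (sq2 : (size q2 <= d.+1)%N).
Hypothesis sylvester_full : row_full (coef_rows (d + d) (sylvester_rows (d := d) q0 q1)).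

(** In the Leibniz expansion of det (q2 Id - E) = 0, every term except q2^d carries a factor from E,
    which is linear in q0 and q1, and so has exponent of q2 below d. *)
Lemma span_expr_d : lin_span (is_mon d d) (q2 ^+ d).
Proof.
have sXM (j : 'I_d) (q : {poly K}) : (size q <= d.+1)%N -> (size ('X^j * q)%R <= d + d)%N.
  move=> sq; rewrite (leq_trans (size_polyMleq _ _)) // size_polyXn addSn /=.
  by rewrite (leq_trans (leq_add (leqnn j) sq)) // addnS -addSn leq_add2r.
have szS a : (size (sylvester_rows (d := d) q0 q1 a) <= d + d)%N.
  by rewrite /sylvester_rows; case: split => j; apply: sXM.
have /fin_all_exists[c cE] (j : 'I_d) : exists c : 'rV_(d + d),
    'X^j * q2 = \sum_i c 0 i *: sylvester_rows q0 q1 i.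
  by have /(coef_rows_fullP szS) := sylvester_full; apply; apply: sXM.
(* q2 v = (q0 A + q1 B) v for v = (1, X, ..., X^(d-1)) *)
pose A i j := lsubmx (c i) 0 j; pose B i j := rsubmx (c i) 0 j.
pose E i j : {poly K} := q0 * (A i j)%:P + q1 * (B i j)%:P.
pose M := \matrix_(i < d, j < d) ((i == j)%:R * q2 - E i j).
pose v := \col_(j < d) ('X^j : {poly K}).
have Mv : M *m v = 0.
  apply/colP => i; rewrite !mxE.
  under eq_bigr do rewrite !mxE mulrBl.
  rewrite sumrB (_ : \sum_j _ = 'X^i * q2); last first.
    rewrite (bigD1 i) //= eqxx mul1r mulrC big1 ?addr0 // => j /negPf ij.
    by rewrite eq_sym ij !mul0r.
  rewrite cE big_split_ord /= -big_split -sumrB big1 //= => j _.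
  rewrite /sylvester_rows (unsplitK (inl j)) (unsplitK (inr j)) /E /A /B !mxE -!mul_polyC.
  by ring.
(* The adjugate gives det M v = 0, and the first entry of v is 1. *)
have dM : \det M = 0.
  have := congr1 (mulmx (\adj M)) Mv; rewrite mulmx0 mulmxA mul_adj_mx mul_scalar_mx.
  move/colP/(_ (Ordinal d_gt0)); rewrite !mxE expr0 mulr1; exact.
(* A product of n entries of M equals its part in q2^n modulo products with smaller exponent of
   q2. *)
have prodE (s : 'I_d -> 'I_d) (r : seq 'I_d) : lin_span (is_mon (size r) (size r))
    (\prod_(i <- r) M i (s i) - \prod_(i <- r) (i == s i)%:R * q2 ^+ size r).
  elim: r => [|i r IH]; first by rewrite !big_nil mulr1 subrr; apply: lin_span0.
  set n := size r in IH *; rewrite !big_cons mxE; set w := _ - _ in IH.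
  set e : {poly K} := (i == s i)%:R; set pi := \prod_(j <- r) (j == s j)%:R in w IH *.
  have -> : \prod_(j <- r) M j (s j) = pi * q2 ^+ n + w by rewrite /w addrC subrK.
  have piE : pi = (\prod_(j <- r) (j == s j)%:R : K)%:P.
    by rewrite rmorph_prod; apply: eq_bigr => j _; rewrite rmorph_nat.
  have eE : e = ((i == s i)%:R : K)%:P by rewrite rmorph_nat.
  have hq2 : lin_span (is_mon n.+1 n) (q2 ^+ n).
    by apply: lin_span_gen; exists 0, 0, n; split=> //; rewrite !expr0 !mul1r.
  have hE p : lin_span (is_mon n.+1 n) p -> lin_span (is_mon n.+1 n.+1) (E i (s i) * p).
    move=> hp; rewrite mulrDl -!mulrA ![_ * (_%:P * _)]mulrCA !mul_polyC.
    by apply: lin_spanD; apply: lin_spanZ; [apply: span_mul0 | apply: span_mul1].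
  (* This is (e q2 - E) (pi q2^n + w) without its leading term e pi q2^(n+1). *)
  rewrite (_ : _ - _ = e * (q2 * w) + (-1 : K) *: (E i (s i) * w) + (-1 : K) *: (pi * (E i (s i) * q2 ^+ n))).
    rewrite eE piE !mul_polyC; do !apply: lin_spanD; do ?apply: lin_spanZ.
    - exact: span_mul2.
    - by apply: hE; apply: span_widen IH.
    - exact: hE.
  rewrite exprS !scaleN1r; ring.
(* Writing the leading term with the determinant of the identity matches the two Leibniz sums term
   by term. *)
have : lin_span (is_mon d d) (\det M - \det (1%:M : 'M_d) * q2 ^+ d).
  rewrite /determinant mulr_suml -sumrB; apply: lin_span_sum => s _.
  rewrite -mulrA -mulrBr.
  have -> : (-1) ^+ s = ((-1) ^+ s : K)%:P by rewrite rmorphXn rmorphN1.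
  rewrite mul_polyC; apply: lin_spanZ.
  have := prodE s (enum 'I_d); rewrite size_enum_ord.
  rewrite !big_enum /=; congr lin_span; congr (_ - _ * _).
  by apply: eq_bigr => i _; rewrite mxE.
rewrite dM det1 mul1r sub0r => /(lin_spanZ (-1)); by rewrite scaleN1r opprK.
Qed.

(** Division by a monic equation: replacing a factor q2^d by means of [span_expr_d] strictly lowers
    the exponent of q2. *)
Lemma span_mon i j l : lin_span (is_mon d (i + j + l)) (q0 ^+ i * q1 ^+ j * q2 ^+ l).
Proof.
have [n ln] := ubnP l; elim: n l i j ln => // n IH l i j ln.
have [ld|dl] := ltnP l d; first by apply: lin_span_gen; exists i, j, l.
rewrite -{2}(subnK dl) exprD mulrA.
apply: (lin_span_linear (mulr_linear _) _ span_expr_d) => _ [i' [j' [l' [l'd E ->]]]].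
rewrite (_ : _ * _ = q0 ^+ (i + i') * q1 ^+ (j + j') * q2 ^+ (l - d + l')); last first.
  by rewrite !exprD; ring.
by rewrite (_ : i + j + l = i + i' + (j + j') + (l - d + l'))%N; [apply: IH; lia | lia].
Qed.

Lemma mon_red_mon k i j l : (i + j + l = k)%N -> exists c : 'rV[K]_#|red_idx d k|,
  q0 ^+ i * q1 ^+ j * q2 ^+ l = \sum_a c 0 a *: red_mon q0 q1 q2 a.
Proof.
move=> <-; apply: lin_span_family (span_mon i j l) => _ [i' [j' [l' [l'd E ->]]]].
have ik : (i' < (i + j + l).+1)%N by lia.
have zP : (Ordinal l'd, Ordinal ik) \in red_idx d (i + j + l) by rewrite inE /=; lia.
exists (enum_rank_in zP (Ordinal l'd, Ordinal ik)); rewrite /red_mon enum_rankK_in //=.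
by congr (_ * _ ^+ _ * _); lia.
Qed.

End Reduction.

(** * The triple (x^d, y^d, x y^(d-1) + x^(d-1) y), dehomogenised *)

Section Example.
Variables (K : fieldType) (d k : nat).
Hypothesis hd : (3 <= d)%N.
Local Notation q0 := ('X^d : {poly K}).
Local Notation q1 := (1 : {poly K}).
Local Notation q2 := ('X + 'X^(d - 1) : {poly K}).

Lemma size_red_mon (p0 p1 p2 : {poly K}) (a : 'I_#|red_idx d k|) :
  (size p0 <= d.+1)%N -> (size p1 <= d.+1)%N -> (size p2 <= d.+1)%N ->
  (size (red_mon p0 p1 p2 a) <= (d * k).+1)%N.
Proof.
have := enum_valP a; rewrite inE /red_mon; set z := enum_val a => zk s0 s1 s2.
have sX (p : {poly K}) n : (size p <= d.+1)%N -> (size (p ^+ n)%R <= (d * n).+1)%N.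
  move=> sp; apply: leq_trans (size_poly_exp_leq _ _) _.
  by rewrite ltnS leq_mul2r -subn1 leq_subLR sp orbT.
have sM (p q : {poly K}) m n : (size p <= m.+1)%N -> (size q <= n.+1)%N ->
    (size (p * q)%R <= (m + n).+1)%N.
  move=> sp sq; apply: leq_trans (size_polyMleq _ _) _.
  by rewrite -subn1 leq_subLR add1n -addSn -addnS leq_add.
have -> : (d * k = d * z.2 + d * (k - (z.1 + z.2)) + d * z.1)%N.
  by rewrite -!mulnDr addnAC (addnC (z.2 : nat)) subnKC.
by apply: (sM); [apply: (sM); apply: sX | apply: sX].
Qed.

(** The rows are X^(d+j) and X^j for j < d, that is, all monomials of degree below 2d. *)
Lemma example_sylvester : row_full (coef_rows (d + d) (sylvester_rows (d := d) q0 q1)).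
Proof.
apply/coef_rows_fullP => [a|p sp].
  rewrite /sylvester_rows; case: split => j; rewrite -?exprD ?mulr1 size_polyXn.
    by rewrite -addSn leq_add2r.
  by rewrite ltn_addr.
exists (row_mx (\row_(j < d) p`_(d + j)) (\row_(j < d) p`_j)).
rewrite -[LHS](coefK p) poly_def (big_ord_widen _ (fun i => p`_i *: 'X^i) sp) big_mkcond /=.
under eq_bigr => i _.
  rewrite (_ : (if _ then _ else _) = p`_i *: 'X^i); last first.
    by case: ltnP => // /(nth_default 0) ->; rewrite scale0r.
  over.
rewrite !big_split_ord /= addrC; congr (_ + _); apply: eq_bigr => j _.
  by rewrite /sylvester_rows (unsplitK (inl j)) row_mxEl mxE -exprD addnC.
by rewrite /sylvester_rows (unsplitK (inr j)) row_mxEr mxE mulr1.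
Qed.

Lemma example_size : [/\ (size q0 <= d.+1)%N, (size q1 <= d.+1)%N & (size q2 <= d.+1)%N].
Proof.
rewrite size_polyXn size_poly1; split=> //.
by rewrite (leq_trans (size_polyD _ _)) // geq_max size_polyX size_polyXn; lia.
Qed.

(** This exhibits the order at X = 0: the second factor has constant term 1 because d > 2. *)
Lemma red_mon_example (a : 'I_#|red_idx d k|) : red_mon q0 q1 q2 a =
  'X^(d * (enum_val a).2 + (enum_val a).1) * (1 + 'X^(d - 2)) ^+ (enum_val a).1.
Proof.
rewrite /red_mon expr1n mulr1 -exprM exprD -mulrA -exprMn mulrDr mulr1 -exprS.
by rewrite (_ : (d - 2).+1 = d - 1)%N //; lia.
Qed.

(* The product x^(d i) y^(d j) f3^l has x-order d i + l, and l < d. *)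
Lemma example_free : row_free (coef_rows (d * k).+1 (red_mon (d := d) (k := k) q0 q1 q2)).
Proof.
have [s0 s1 s2] := example_size.
apply/coef_rows_freeP => [a|c cE]; first exact: size_red_mon.
pose ord (a : 'I_#|red_idx d k|) := (d * (enum_val a).2 + (enum_val a).1)%N.
have ord_inj : injective ord.
  move=> a b ab; apply: enum_val_inj.
  have d_gt0 : (0 < d)%N by lia.
  have lt (a' : 'I_#|red_idx d k|) : ((enum_val a').1 < d)%N := ltn_ord (enum_val a').1.
  rewrite [LHS]surjective_pairing [RHS]surjective_pairing; congr (_, _); apply: val_inj => /=.
    have := congr1 (modn^~ d) ab.
    by rewrite /ord /= ![(d * _)%N]mulnC !modnMDl !modn_small.
  have := congr1 (divn^~ d) ab.
  by rewrite /ord /= ![(d * _)%N]mulnC !divnMDl // !divn_small // !addn0.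
apply/eqP/negPn/negP => c0.
have [a0 ca0] : exists a, c 0 a != 0.
  by apply/existsP; apply: contraNT c0; rewrite negb_exists => /forallP c0;
     apply/eqP/rowP => a; rewrite mxE; apply/eqP; have := c0 a; rewrite negbK.
(* Orders are distinct, so the term of least order alone contributes to the coefficient of X^(ord
   a). *)
case: (@arg_minnP _ a0 (fun a => c 0 a != 0) ord ca0) => a ca amin.
have := congr1 (fun p : {poly K} => p`_(ord a)) cE; rewrite coef0 coef_sum (bigD1 a) //=.
rewrite big1 => [|b ba].
  rewrite coefZ red_mon_example coefXnM ltnn subnn -horner_coef0 !hornerE expr0n.
  rewrite (_ : (d - 2 == 0)%N = false) ?addr0 ?expr1n ?mulr1; last by lia.
  by move/eqP; rewrite (negPf ca).
have [-> | cb] := eqVneq (c 0 b) 0; first by rewrite scale0r coef0.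
rewrite coefZ red_mon_example coefXnM (_ : (_ < _)%N) ?mulr0 //.
by rewrite ltn_neqAle amin // andbT; apply: contraNneq ba => /ord_inj ->.
Qed.

Definition example_rows (p : {poly K}) : Prop := exists a,
  p = mulX_rows (red_mon (d := d) (k := k) q0 q1 q2) a.

Lemma example_rows_mon (e : bool) l i : (l < d)%N -> (i + l <= k)%N ->
  example_rows ('X^e * ('X^(d * i) * q2 ^+ l)).
Proof.
move=> ld lik; have ik : (i < k.+1)%N by lia.
have zP : (Ordinal ld, Ordinal ik) \in red_idx d k by rewrite inE /=; lia.
pose a := enum_rank_in zP (Ordinal ld, Ordinal ik).
have aE : red_mon q0 q1 q2 a = 'X^(d * i) * q2 ^+ l.
  by rewrite /red_mon enum_rankK_in // expr1n mulr1 -exprM.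
case: e; [exists (lshift _ a) | exists (rshift _ a)]; rewrite /mulX_rows.
  by rewrite (unsplitK (inl a)) aE expr1.
by rewrite (unsplitK (inr a)) aE expr0 mul1r.
Qed.

(* These are the monomials of x^(d i) f3^l and x^(d i + 1) f3^l.  All of them but
   the one with e = 1, m = 0, resp. e = 0, m = l, occur for a smaller l. *)
Lemma example_span_mon (e : bool) l m i : (l < d)%N -> (m <= l)%N -> (i + l <= k)%N ->
  lin_span example_rows ('X^(e + l + (d - 2) * m + d * i)).
Proof.
have [n ln] := ubnP l; elim: n l m i e ln => // n IH l m i e ln ld ml lik.
(* The exponent l drops by the relations (x y^(d-1)) (x^(d-1) y) = x^d y^d, x (x^(d-1) y) = y x^d
   and y (x y^(d-1)) = x y^d. *)
have other (m' : 'I_l.+1) : (m' : nat) != (if e then 0 else l)%N ->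
    lin_span example_rows ('X^(e + l + (d - 2) * m' + d * i)).
  case: m' => m' /=; rewrite ltnS => m'l; case: e => /= m'0.
    have [m'E|m'E] := eqVneq m' l.
      rewrite (_ : _ + _ = false + l.-1 + (d - 2) * l.-1 + d * i.+1)%N; first by apply: IH; lia.
      case: (l) m'E m'0 => [|l'] -> //= _; have [d' ->] : exists d', d = d'.+2 by exists (d - 2)%N; lia.
      by rewrite !subSS subn0; nia.
    rewrite (_ : _ + _ = true + (l - 2) + (d - 2) * m'.-1 + d * i.+1)%N; first by apply: IH; lia.
    have [d' ->] : exists d', d = d'.+2 by exists (d - 2)%N; lia.
    have [l' ->] : exists l', l = l'.+2 by exists (l - 2)%N; lia.
    case: m' m'0 {m'l m'E} => // m' _; rewrite !subSS !subn0 /=; nia.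
  case: m' m'0 m'l => [|m'] m'0 m'l.
    rewrite (_ : _ + _ = true + l.-1 + (d - 2) * 0 + d * i)%N; first by apply: IH; lia.
    by lia.
  rewrite (_ : _ + _ = false + (l - 2) + (d - 2) * m' + d * i.+1)%N; first by apply: IH; lia.
  have [d' ->] : exists d', d = d'.+2 by exists (d - 2)%N; lia.
  have [l' ->] : exists l', l = l'.+2 by exists (l - 2)%N; lia.
  by rewrite !subSS !subn0; nia.
have [m0|m0] := eqVneq m (if e then 0 else l)%N; last first.
  exact: (other (Ordinal (ml : (m < l.+1)%N)) m0).
have expand : 'X^e * ('X^(d * i) * q2 ^+ l) =
    \sum_(m' < l.+1) ('C(l, m'))%:R *: ('X^(e + l + (d - 2) * m' + d * i) : {poly K}).
  rewrite exprDn !mulr_sumr; apply: eq_bigr => m' _.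
  rewrite scaler_nat !mulrnAr -exprM -!exprD; congr ('X^_ *+ _).
  have := ltn_ord m'; have [d' ->] : exists d', d = d'.+2 by exists (d - 2)%N; lia.
  by rewrite !subSS !subn0; nia.
have gen := lin_span_gen (example_rows_mon e ld lik); rewrite expand in gen.
move: gen; rewrite (bigD1 (Ordinal (ml : (m < l.+1)%N))) //=.
(* The remaining monomial is an end term of the binomial expansion, so it can be solved for in any
   characteristic. *)
have -> : 'C(l, m) = 1%N by rewrite m0; case: (e); rewrite ?bin0 ?binn.
rewrite scale1r; set w := \sum_(_ < _ | _) _ => gen.
rewrite -[X in lin_span _ X](addrK w) -scaleN1r; apply: lin_spanD => //.
apply: lin_spanZ; apply: lin_span_sum => m' m'm; apply: lin_spanZ; apply: other.
by rewrite -m0.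
Qed.

Hypothesis hk : (d - 2 <= k)%N.

(** Every exponent d i + a <= d k + 1 with a < d is brought to the form in [example_span_mon], with
    m = 0 or m = l. *)
Lemma example_full :
  row_full (coef_rows (d * k).+2 (mulX_rows (red_mon (d := d) (k := k) q0 q1 q2))).
Proof.
have [s0 s1 s2] := example_size.
apply/coef_rows_fullP => [a|p sp].
  rewrite /mulX_rows; case: split => b; last by rewrite leqW ?size_red_mon.
  by rewrite mulrC (leq_trans (size_polyMleq _ _)) // size_polyX addn2 /= ltnS size_red_mon.
apply: (@lin_span_family _ _ example_rows) => // {s0 s1 s2}.
rewrite -(coefK p) poly_def; apply: lin_span_sum => -[n /= np] _; apply: lin_spanZ.
have {np sp} : (n < (d * k).+2)%N by apply: leq_trans sp.
rewrite (divn_eq n d) mulnC; have : (n %% d < d)%N by rewrite ltn_mod; lia.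
move: (n %/ d)%N (n %% d)%N => i a ad; have [d' dE] : exists d', d = d'.+2 by exists (d - 2)%N; lia.
have [a1 lt_n|a2 lt_n] := leqP a 1.
  have ik : (i <= k)%N by nia.
  rewrite (_ : _ + _ = (a == 1) + 0 + (d - 2) * 0 + d * i)%N; last by case: a a1 {ad lt_n} => [|[|]] //; lia.
  by apply: example_span_mon; lia.
have ik : (i < k)%N by nia.
have [h|h] := leqP (i + a.-1) k.
  rewrite (_ : _ + _ = true + a.-1 + (d - 2) * 0 + d * i)%N; last by rewrite /=; lia.
  by apply: example_span_mon; lia.
(* Now i + a > k + 1 >= d - 1, so c = d - a <= i. Then X^(d i + a) = X^(d j) (X^(d-1))^c with j + c
   = i + 1 <= k. *)
have [c aE] : exists c, (a + c = d)%N by exists (d - a)%N; lia.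
have [j iE] : exists j, (i.+1 = c + j)%N by exists (i.+1 - c)%N; lia.
rewrite (_ : _ + _ = false + c + (d - 2) * c + d * j)%N; first by apply: example_span_mon; lia.
by rewrite dE !subSS subn0 /=; nia.
Qed.

End Example.

(** * Openness of rank conditions *)

Section ZariskiNeighbourhood.
Variables (K : fieldType) (n : nat).
Implicit Types (v w : 'rV[K]_n) (P Q : 'rV[K]_n -> Prop).
Local Notation ev v := (meval (fun i => v 0 i)).

(** Principal open sets form a base of the topology, so one polynomial is enough; intersections
    become products. *)
Definition zariski_near v P : Prop :=
  exists2 p : {mpoly K[n]}, ev v p != 0 & forall w, ev w p != 0 -> P w.

Lemma zariski_nearI v P Q : zariski_near v P -> zariski_near v Q ->
  zariski_near v (fun w => P w /\ Q w).
Proof.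
move=> [p pv Hp] [q qv Hq]; exists (p * q); first by rewrite mevalM mulf_neq0.
by move=> w; rewrite mevalM mulf_eq0 negb_or => /andP[/Hp ? /Hq].
Qed.

(** A right inverse B of M at v is kept constant: det (M B) is 1 at v, and M has full row rank
    wherever it is nonzero. *)
Lemma row_free_near a b (M : 'M[{mpoly K[n]}]_(a, b)) v :
  row_free (map_mx (ev v) M) -> zariski_near v (fun w => row_free (map_mx (ev w) M)).
Proof.
move=> /row_freeP[B MB].
have evM w : ev w (\det (M *m map_mx (mpolyC n (R:=K)) B)) = \det (map_mx (ev w) M *m B).
  rewrite -det_map_mx map_mxM; congr (\det (_ *m _)).
  by apply/matrixP => i j; rewrite !mxE /= mevalC.
exists (\det (M *m map_mx (mpolyC n (R:=K)) B)); first by rewrite evM MB det1 oner_neq0.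
move=> w; rewrite evM -unitfE -[_ \is a _]/(_ \in unitmx) -row_free_unit => /eqP MBf.
by rewrite /row_free eqn_leq rank_leq_row -[X in (X <= _)%N]MBf mxrankM_maxl.
Qed.

Lemma row_full_near a b (M : 'M[{mpoly K[n]}]_(a, b)) v :
  row_full (map_mx (ev v) M) -> zariski_near v (fun w => row_full (map_mx (ev w) M)).
Proof.
have tr w : row_full (map_mx (ev w) M) = row_free (map_mx (ev w) M^T).
  by rewrite /row_full /row_free -map_trmx mxrank_tr.
by rewrite tr => /row_free_near[p pv Hp]; exists p => // w /Hp; rewrite tr.
Qed.

End ZariskiNeighbourhood.

(** * From the example to general forms *)

Section GenericForms.
Variables (K : fieldType) (d k : nat).
Implicit Types v w : 'rV[K]_(3 * d.+1).
Local Notation ev v := (meval (fun i => v 0 i)).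
Local Notation o0 := (ord0 : 'I_3).
Local Notation o1 := (Ordinal (isT : 1 < 3)%N).
Local Notation o2 := (ord_max : 'I_3).

Definition good_triple (q : 'I_3 -> {poly K}) : Prop :=
  row_full (coef_rows (d + d) (sylvester_rows (d := d) (q o0) (q o1))) /\
  (row_free (coef_rows (d * k).+1 (red_mon (d := d) (k := k) (q o0) (q o1) (q o2))) /\
   row_full (coef_rows (d * k).+2 (mulX_rows (red_mon (d := d) (k := k) (q o0) (q o1) (q o2))))).

(** The coefficients are the coordinate functions on the space of triples, numbered by [mxvec] as in
    [for_general_forms]. *)
Definition generic_form (i : 'I_3) : {poly {mpoly K[3 * d.+1]}} :=
  \sum_(j < d.+1) 'X_(mxvec_index i j) *: 'X^j.

Definition form_at (v : 'rV[K]_(3 * d.+1)) (i : 'I_3) : {poly K} :=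
  \sum_(j < d.+1) v 0 (mxvec_index i j) *: 'X^j.

Lemma map_generic_form v i : map_poly (ev v) (generic_form i) = form_at v i.
Proof.
rewrite rmorph_sum; apply: eq_bigr => j _.
by rewrite -!mul_polyC rmorphM /= map_polyC map_polyXn /= mevalXU.
Qed.

Lemma form_at_mxvec (q : 'I_3 -> {poly K}) (A : 'M_(3, d.+1)) i :
  (forall i, size (q i) <= d.+1)%N -> (forall i j, A i j = (q i)`_j) ->
  form_at (mxvec A) i = q i.
Proof.
move=> sq AE; rewrite /form_at; under eq_bigr do rewrite mxvecE AE.
by rewrite -poly_def; apply/polyP => j; rewrite coef_poly; case: ltnP => // /(leq_trans (sq i))/(nth_default 0).
Qed.

Lemma map_coef_rows (A B : nzRingType) (f : {rmorphism A -> B}) m n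
    (p : 'I_m -> {poly A}) (q : 'I_m -> {poly B}) :
  (forall i, map_poly f (p i) = q i) -> map_mx f (coef_rows n p) = coef_rows n q.
Proof. by move=> pq; apply/matrixP => i j; rewrite !mxE -pq coef_map. Qed.

(** The three matrices are specialisations of those built from [generic_form], so their rank
    conditions are open. *)
Lemma good_near v : good_triple (form_at v) -> zariski_near v (fun w => good_triple (form_at w)).
Proof.
have redE w : map_poly (ev w) \o red_mon (generic_form o0) (generic_form o1) (generic_form o2)
    =1 red_mon (d := d) (k := k) (form_at w o0) (form_at w o1) (form_at w o2).
  by move=> a /=; rewrite (rmorph_red_mon (map_poly (ev w))) /= !map_generic_form.
have mulXE w a : map_poly (ev w) (mulX_rows (red_mon (generic_form o0) (generic_form o1) (generic_form o2)) a)
    = mulX_rows (red_mon (d := d) (k := k) (form_at w o0) (form_at w o1) (form_at w o2)) a.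
  by rewrite /mulX_rows; case: (split a) => b; [rewrite rmorphM /= map_polyX -redE | apply: redE].
have sylE w a : map_poly (ev w) (sylvester_rows (d := d) (generic_form o0) (generic_form o1) a)
    = sylvester_rows (form_at w o0) (form_at w o1) a.
  by rewrite /sylvester_rows; case: (split a) => b; rewrite rmorphM /= map_polyXn map_generic_form.
move=> [fs [fr ff]].
apply: zariski_nearI.
  rewrite -(map_coef_rows _ (sylE v)) in fs; have [p pv Hp] := row_full_near fs.
  by exists p => // w /Hp; rewrite (map_coef_rows _ (sylE w)).
apply: zariski_nearI.
  rewrite -(map_coef_rows _ (redE v)) in fr; have [p pv Hp] := row_free_near fr.
  by exists p => // w /Hp; rewrite (map_coef_rows _ (redE w)).
rewrite -(map_coef_rows _ (mulXE v)) in ff; have [p pv Hp] := row_full_near ff.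
by exists p => // w /Hp; rewrite (map_coef_rows _ (mulXE w)).
Qed.

Lemma for_general_good (P : ('I_3 -> {mpoly K[2]}) -> Prop) : (3 <= d)%N -> (d - 2 <= k)%N ->
  (forall f, (forall i, f i \is d.-homog) -> good_triple (fun i => dehomog (f i)) -> P f) ->
  @for_general_forms K 3 d P.
Proof.
move=> hd hk HP; pose q (i : 'I_3) : {poly K} :=
  if i == o0 then 'X^d else if i == o1 then 1 else 'X + 'X^(d - 1).
have [s0 s1 s2] := example_size K hd.
have sq i : (size (q i) <= d.+1)%N by rewrite /q; do 2?case: ifP.
pose v := mxvec (\matrix_(i < 3, j < d.+1) (q i)`_j).
have vE i : form_at v i = q i by apply: form_at_mxvec => // ? ?; rewrite mxE.
have [|p pv Hp] := @good_near v.
  rewrite /good_triple !vE; split; first exact: example_sylvester.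
  by split; [apply: example_free | apply: example_full].
exists (fun w => ev w p != 0); split.
- exists (eq p) => w; split=> [pw|[_ <-]] //; by exists p.
- by exists v.
- move=> f hf /Hp; set w := mxvec _ => gw; apply: HP => //.
  have wE i : form_at w i = dehomog (f i).
    apply: (form_at_mxvec (q := fun i => dehomog (f i))) => [{}i|{}i j].
      exact: size_dehomog.
    by rewrite mxE (coef_dehomog (hf i)) // -ltnS.
  by move: gw; rewrite /good_triple !wE.
Qed.

End GenericForms.

(** * The ideal I is generated by the N products with l < d *)

Section PowerIdeal.
Variables (K : fieldType) (d k : nat).
Local Notation S := {mpoly K[2]}.
Local Notation o0 := (ord0 : 'I_3).
Local Notation o1 := (Ordinal (isT : 1 < 3)%N).
Local Notation o2 := (ord_max : 'I_3).
Variable f : 'I_3 -> S.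

Definition red_col : 'cV[S]_#|red_idx d k| := \col_a red_mon (f o0) (f o1) (f o2) a.

Lemma mon_prod i j l : (i + j + l = k)%N -> exists h : 'I_k -> S,
  (forall t, exists s, h t = f s) /\ f o0 ^+ i * f o1 ^+ j * f o2 ^+ l = \prod_t h t.
Proof.
move=> <-; exists (fun t : 'I__ => if (t < i)%N then f o0 else if (t < i + j)%N then f o1 else f o2).
split=> [t|]; first by do 2?[case: ifP => _]; [exists o0 | exists o1 | exists o2].
rewrite !big_split_ord /=; congr (_ * _ * _).
- by under eq_bigr => t _ do rewrite ltn_ord; rewrite prodr_const card_ord.
- under eq_bigr => t _ do rewrite ltnNge leq_addr ltn_add2l ltn_ord.
  by rewrite prodr_const card_ord.
- under eq_bigr => t _ do rewrite ltnNge -addnA leq_addr /= addnA ltnNge leq_addr /=.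
  by rewrite prodr_const card_ord.
Qed.

Hypothesis hf : forall i, f i \is d.-homog.
Hypothesis d_gt0 : (0 < d)%N.
Hypothesis f_sylv : row_full (coef_rows (d + d)
  (sylvester_rows (d := d) (dehomog (f o0)) (dehomog (f o1)))).

Lemma mon_homog i j l : (i + j + l = k)%N ->
  f o0 ^+ i * f o1 ^+ j * f o2 ^+ l \is (d * k).-homog.
Proof. by move=> <-; rewrite !mulnDr; do 2?apply: dhomogM; apply: dhomogMn. Qed.

Lemma red_col_homog a : red_col a 0 \is (d * k).-homog.
Proof.
rewrite mxE /red_mon; have := enum_valP a; rewrite inE => zk; apply: mon_homog.
by rewrite addnAC (addnC ((enum_val a).2 : nat)) subnKC.
Qed.

Lemma dehomog_red_col a :
  dehomog (red_col a 0) = red_mon (dehomog (f o0)) (dehomog (f o1)) (dehomog (f o2)) a.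
Proof. by rewrite mxE (rmorph_red_mon (@dehomog K)). Qed.

Lemma mon_in_red_col i j l : (i + j + l = k)%N ->
  exists u : 'rV_#|red_idx d k|, f o0 ^+ i * f o1 ^+ j * f o2 ^+ l = (u *m red_col) 0 0.
Proof.
move=> ijl; have sf s := size_dehomog (hf s).
have [c cE] := mon_red_mon d_gt0 (sf o0) (sf o1) (sf o2) f_sylv ijl.
exists (map_mx (mpolyC 2 (R:=K)) c); apply: (dehomog_inj (mon_homog ijl)).
  rewrite mxE rpred_sum // => a _; rewrite mxE mul_mpolyC rpredZ //.
  exact: red_col_homog.
rewrite dehomog_cst !rmorphM !rmorphXn /= cE.
by apply: eq_bigr => a _; rewrite dehomog_red_col.
Qed.

Lemma ideal_pow_red_col p : ideal_pow (ideal_gen (fun q => exists i, q = f i)) k p <->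
  exists u : 'rV_#|red_idx d k|, p = (u *m red_col) 0 0.
Proof.
pose J q := exists u : 'rV_#|red_idx d k|, q = (u *m red_col) 0 0.
have J0 : J 0 by exists 0; rewrite mul0mx mxE.
have JD q r : J q -> J r -> J (q + r).
  by move=> [u ->] [v ->]; exists (u + v); rewrite mulmxDl [in RHS]mxE.
have JM q r : J r -> J (q * r).
  by move=> [u ->]; exists (q *: u); rewrite -scalemxAl [in RHS]mxE.
have Jsum m (F : 'I_m -> S) : (forall i, J (F i)) -> J (\sum_i F i).
  by move=> H; apply: big_ind.
split=> [[m [c [h [hh ->]]]]|[u ->]].
  apply: (Jsum) => a; apply: (JM); have [h' [hI ->]] := hh a; move: h' hI.
  (* The k factors are expanded one at a time: i, j and l count the generators already chosen, n the
     factors left. *)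
  suff H n : forall (h' : 'I_n -> S) i j l, (i + j + l + n = k)%N ->
      (forall t, ideal_gen (fun q => exists i, q = f i) (h' t)) ->
      J (f o0 ^+ i * f o1 ^+ j * f o2 ^+ l * \prod_t h' t).
    by move=> h' hI; have := H k h' 0 0 0 erefl hI; rewrite !expr0 !mul1r.
  elim: n => [|n IH] h' i j l ijl hI.
    by rewrite big_ord0 mulr1; apply: mon_in_red_col; rewrite -ijl addn0.
  rewrite big_ord_recl mulrA; have [r [e [q [qf ->]]]] := hI ord0.
  rewrite mulr_sumr mulr_suml; apply: (Jsum) => t; have [s ->] := qf t.
  set P := \prod_(_ < _) _; set M := _ * _ ^+ l.
  rewrite mulrCA -mulrA.
  apply: (JM); case: s => -[|[|[|//]]] lt3.
  - rewrite (_ : Ordinal lt3 = o0) /M; last exact: val_inj.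
    rewrite (_ : _ * f o0 = f o0 ^+ i.+1 * f o1 ^+ j * f o2 ^+ l); last by rewrite exprS; ring.
    by apply: IH => //; lia.
  - rewrite (_ : Ordinal lt3 = o1) /M; last exact: val_inj.
    rewrite (_ : _ * f o1 = f o0 ^+ i * f o1 ^+ j.+1 * f o2 ^+ l); last by rewrite exprS; ring.
    by apply: IH => //; lia.
  - rewrite (_ : Ordinal lt3 = o2) /M; last exact: val_inj.
    rewrite (_ : _ * f o2 = f o0 ^+ i * f o1 ^+ j * f o2 ^+ l.+1); last by rewrite exprS; ring.
    by apply: IH => //; lia.
exists #|red_idx d k|, (fun a => u 0 a), (fun a => red_col a 0); rewrite mxE; split=> // a.
have := enum_valP a; rewrite inE => zk.
have [|h [hf' E]] := @mon_prod (enum_val a).2 (k - ((enum_val a).1 + (enum_val a).2)) (enum_val a).1.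
  by rewrite addnAC (addnC ((enum_val a).2 : nat)) subnKC.
exists h; split; last by rewrite mxE -E.
move=> t; have [s ->] := hf' t; exists 1%N, (fun=> 1), (fun=> f s).
by split=> [_|]; [exists s | rewrite big_ord1 mul1r].
Qed.

End PowerIdeal.

(** * The closed formulas and the conclusion *)

Lemma coef_hilbert_poly (D c n : nat) :
  (\sum_(i < D) (i.+1)%:P * 'X^i + c%:P * 'X^D : {poly nat})`_n =
  (if (n < D)%N then n.+1 else if n == D then c else 0%N).
Proof.
rewrite coefD coefCM coefXn coef_sum.
under eq_bigr do rewrite coefCM coefXn.
case: ltnP => [nD|Dn].
  rewrite (bigD1 (Ordinal nD)) //= eqxx big1 => [|i /negPf ni].
    by rewrite (ltn_eqF nD) mulr0 !addr0 mulr1.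
  by rewrite eq_sym -val_eqE /= in ni *; rewrite ni mulr0.
rewrite big1 => [|i _]; last by rewrite gtn_eqF ?mulr0 // (leq_trans (ltn_ord i)).
by rewrite add0r; case: eqP; rewrite ?mulr1 ?mulr0.
Qed.

(** Subtraction is truncated and division is integral: d (d - 2) <= d k makes the differences exact,
    and 2 C(d-1,2) = (d - 1) (d - 2) the quotient. *)
Lemma betti_numbers d k N : (3 <= d)%N -> (d - 2 <= k)%N -> (N + 'C(d - 1, 2) = (d * k).+1)%N ->
  ((2 * d * k + 3 * d - d ^ 2) %/ 2 = N /\
   d * k + 3 * d - d ^ 2 - 2 + (d * k).+2 = N + N)%N.
Proof.
move=> hd hk cN; have bE : (2 * 'C(d - 1, 2) = (d - 1) * (d - 2))%N.
  by rewrite -mul_bin_diag bin1; congr (_ * _)%N; lia.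
have le_dk : (d * (d - 2) <= d * k)%N by rewrite leq_mul2l hk orbT.
have [e dE] : exists e, d = e.+3 by exists (d - 3)%N; lia.
have dd : ((d - 1) * (d - 2) + 3 * d = d ^ 2 + 2)%N.
  by rewrite dE !subSS !subn0 expnS expn1; nia.
have dd2 : (d * (d - 2) + 2 * d = d ^ 2)%N.
  by rewrite dE !subSS !subn0 expnS expn1; nia.
(* Once the nonlinear terms are generalised, the goal is linear arithmetic. *)
rewrite -mulnA; move: (d * k)%N (d ^ 2)%N ('C(_, _)) (d * _)%N (_ * _)%N cN bE le_dk dd dd2 => *.
by split; lia.
Qed.

Theorem theorem6 (R : realType) (d k : nat) (hd : (3 <= d)%N)
    (hk : (d - 2 <= k)%N) :
  @for_general_forms R[i] 3 d (fun f =>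
    let I := ideal_pow (ideal_gen (fun p => exists i, p = f i)) k in
    hilbert_series I (fun n =>
      (\sum_(i < d * k) (i.+1)%:P * 'X^i
         + ('C(d - 1, 2))%:P * 'X^(d * k) : {poly nat})`_n) /\
    [/\ graded_betti I 0 0 1,
        graded_betti I 1 (d * k) ((2 * d * k + 3 * d - d ^ 2) %/ 2),
        graded_betti I 2 (d * k + 1) (d * k + 3 * d - d ^ 2 - 2),
        graded_betti I 2 (d * k + 2) 'C(d - 1, 2)
      & forall i j : nat,
          (i, j) \notin
            [:: (0, 0); (1, d * k); (2, d * k + 1); (2, d * k + 2)]%N ->
          graded_betti I i j 0]).
Proof.
apply: (@for_general_good _ d k) => // f hf [f_sylv [f_free f_full]] I.
have d_gt0 : (0 < d)%N by lia.
pose g := red_col d k f; pose N := #|red_idx d k|.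
have hg : forall a, g a 0 \is (d * k).-homog by apply: red_col_homog.
have GE : (fun a => dehomog (g a 0)) =1 _ := dehomog_red_col (d := d) (k := k) f.
have g_free : row_free (coef_rows (d * k).+1 (fun a => dehomog (g a 0))).
  by move: f_free; congr row_free; apply/matrixP => a j; rewrite [LHS]mxE [RHS]mxE GE.
have g_full : row_full (coef_rows (d * k).+2 (mulX_rows (fun a => dehomog (g a 0)))).
  move: f_full; congr row_full; apply/matrixP => a j; rewrite [LHS]mxE [RHS]mxE /mulX_rows.
  by case: (split a) => b; rewrite GE.
have Ig p : I p <-> exists u : 'rV_N, p = (u *m g) 0 0 := ideal_pow_red_col k hf d_gt0 f_sylv p.
have cN : (N + 'C(d - 1, 2) = (d * k).+1)%N := card_red_idx d_gt0 hk.
split=> [n|].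
  rewrite coef_hilbert_poly; case: ltngtP => nD.
  - exact: (hilbert_lt hg Ig nD).
  - exact: (hilbert_gt hg g_free g_full Ig nD).
  - by rewrite nD; apply: (hilbert_eq hg g_free Ig); rewrite addnC.
have [-> bE] := betti_numbers hd hk cN.
by rewrite addn1 addn2; apply: (graded_betti_ideal hg g_free g_full Ig) => //; lia.
Qed.
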